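(* Let $d,m\in\mathbb{N}$, let $\mathcal{X}\subseteq\mathbb{R}^d$ be a bounded domain, $\mathcal{Y}=\{-1,1\}$, $\mathcal{Z}=\mathcal{X}\times\mathcal{Y}$, and let $\rho$ be a probability distribution on $\mathcal{Z}$. Let ${\bf z}=\{z_i=(x_i,y_i): i=1,\dots,m\}$ be drawn i.i.d. from $\rho$. Fix $r>0$, $\lambda>0$ and a matrix norm $\|\cdot\|$ on $d\times d$ matrices. For symmetric $A\in\mathbb{S}^{d\times d}$ let $K_A(x,x')=x^TAx'$ and $$\mathcal{E}_{\bf z}(A)=\frac1m\sum_{i=1}^m\Big(1-\frac{1}{mr}\sum_{j=1}^m y_iy_jK_A(x_i,x_j)\Big)_+,$$ and let $A_{\bf z}\in\arg\min_{A\in\mathbb{S}^{d\times d}}\big[\mathcal{E}_{\bf z}(A)+\lambda\|A\|\big]$. For $f:\mathcal{X}\to\mathbb{R}$ let $\mathscr{E}_{\bf z}(f)=\frac1m\sum_{i=1}^m(1-y_if(x_i))_+$ and $\mathscr{E}(f)=\int_{\mathcal{Z}}(1-yf(x))_+\,d\rho(x,y)$, and let $$f_{\bf z}\in\arg\min\Big\{\mathscr{E}_{\bf z}(f) : f=\sum_{j=1}^m\alpha_jK_{A_{\bf z}}(x_j,\cdot),\ \alpha_j\in\mathbb{R},\ \sum_{j=1}^m|\alpha_j|\le 1/r\Big\}.$$ Then for any $0<\delta<1$, with probability at least $1-\delta$ over ${\bf z}$, $$\mathscr{E}(f_{\bf z})-\mathscr{E}_{\bf z}(f_{\bf z})\le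 \frac{4\mathcal{R}_m}{\lambda r}+\frac{2X_*}{\lambda r}\sqrt{\frac{2\log(1/\delta)}{m}},$$ where $X_*=\sup_{x,x'\in\mathcal{X}}\|x'x^T\|_*$ and $\mathcal{R}_m=\mathbb{E}_{{\bf z},\sigma}\Big[\sup_{\tilde x\in\mathcal{X}}\Big\|\frac1m\sum_{i=1}^m\sigma_iy_ix_i\tilde x^T\Big\|_*\Big]$.
   Context: $(t)_+=\max(t,0)$. The dual norm is $\|B\|_*=\sup_{\|A\|\le1}\mathrm{trace}(B^TA)$. In $\mathcal{R}_m$, $\sigma_1,\dots,\sigma_m$ are i.i.d. Rademacher variables ($P(\sigma_i=\pm1)=1/2$) independent of ${\bf z}$, and the expectation is over both ${\bf z}$ and $\sigma$. $\mathbb{S}^{d\times d}$ denotes the symmetric $d\times d$ real matrices. *)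

(* Defs.v *)
From HB Require Import structures.
From mathcomp Require Import all_boot all_order all_algebra.
From mathcomp Require Import all_classical all_reals all_analysis.

Set Implicit Arguments.
Unset Strict Implicit.
Unset Printing Implicit Defensive.

Import Order.TTheory GRing.Theory Num.Theory.
Import numFieldNormedType.Exports.
Local Open Scope classical_set_scope.
Local Open Scope ring_scope.

Definition pos_part {R : realType} (t : R) : R := Num.max t 0.

Definition is_matrix_norm {R : realType} {d : nat} (N : 'M[R]_d -> R) : Prop :=
  [/\ forall A B, N (A + B) <= N A + N B,
      forall (a : R) A, N (a *: A) = `|a| * N A
    & forall A, N A = 0 -> A = 0].

Definition dual_norm {R : realType} {d : nat} (N : 'M[R]_d -> R) (B : 'M[R]_d) : R :=
  sup [set \tr (B^T *m A) | A in [set A : 'M[R]_d | N A <= 1]].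

(* boundedness of the domain: the library's [bounded_set] (sup-norm on matrices) *)

Definition KA {R : realType} {d : nat} (A : 'M[R]_d) (x x' : 'cV[R]_d) : R :=
  (x^T *m A *m x') 0 0.

Definition symmetric_mx {R : realType} {d : nat} (A : 'M[R]_d) : Prop := A^T = A.

Definition Ez_mat {R : realType} {d m : nat} (r : R)
  (xs : 'I_m -> 'cV[R]_d) (ys : 'I_m -> R) (A : 'M[R]_d) : R :=
  (m%:R)^-1 * \sum_(i < m)
     pos_part (1 - ((m%:R * r)^-1) * \sum_(j < m) ys i * ys j * KA A (xs i) (xs j)).

Definition kfun {R : realType} {d m : nat} (A : 'M[R]_d)
  (xs : 'I_m -> 'cV[R]_d) (alpha : 'I_m -> R) (x : 'cV[R]_d) : R :=
  \sum_(j < m) alpha j * KA A (xs j) x.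

Definition emp_risk {R : realType} {d m : nat}
  (xs : 'I_m -> 'cV[R]_d) (ys : 'I_m -> R) (f : 'cV[R]_d -> R) : R :=
  (m%:R)^-1 * \sum_(i < m) pos_part (1 - ys i * f (xs i)).

(* true hinge risk  E(f) = \int_Z (1 - y f(x))_+ d rho(x,y);  a point z of Z
   has input px z and label py z *)
Definition pop_risk {R : realType} {d : nat} {dZ : measure_display}
  {Z : measurableType dZ} (rho : probability Z R)
  (px : Z -> 'cV[R]_d) (py : Z -> R) (f : 'cV[R]_d -> R) : \bar R :=
  (\int[rho]_z (pos_part (1 - py z * f (px z)))%:E)%E.

Definition rsign {R : realType} (b : bool) : R := if b then 1 else -1.

Definition rad_sup {R : realType} {d m : nat} (N : 'M[R]_d -> R)
  (X : set 'cV[R]_d) (xs : 'I_m -> 'cV[R]_d) (ys : 'I_m -> R)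
  (s : {ffun 'I_m -> bool}) : R :=
  sup [set dual_norm N ((m%:R)^-1 *: \sum_(i < m) (rsign (s i) * ys i) *: (xs i *m xt^T))
      | xt in X].

(* expectation over the i.i.d. uniform Rademacher signs (finite average) *)
Definition rad_avg {R : realType} {d m : nat} (N : 'M[R]_d -> R)
  (X : set 'cV[R]_d) (xs : 'I_m -> 'cV[R]_d) (ys : 'I_m -> R) : R :=
  ((2 ^ m)%:R)^-1 * \sum_(s : {ffun 'I_m -> bool}) rad_sup N X xs ys s.

Definition Xstar {R : realType} {d : nat} (N : 'M[R]_d -> R) (X : set 'cV[R]_d) : R :=
  sup [set t | exists x x', [/\ X x, X x' & t = dual_norm N (x' *m x^T)]].

Definition iid_sample {R : realType} {dO dZ : measure_display}
  {Omega : measurableType dO} {Z : measurableType dZ}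
  (P : probability Omega R) (rho : probability Z R) {m : nat}
  (zs : 'I_m -> Omega -> Z) : Prop :=
  [/\ forall i, measurable_fun setT (zs i),
      forall i (B : set Z), measurable B -> P (zs i @^-1` B) = rho B
    & forall B : 'I_m -> set Z, (forall i, measurable (B i)) ->
        P (\bigcap_i (zs i @^-1` B i)) = (\prod_(i < m) P (zs i @^-1` B i))%E].

(* Main.v *)
(* The learned functions are linear forms x |-> <v, x> with v in a set V that
   does not depend on the sample: minimality against A = 0 gives |A_z| <= 1/lambda,
   so v ranges over the combinations of the vectors A u, u in the domain, A symmetric
   with |A| <= 1/lambda, with coefficients of l1-norm at most 1/r.

   For finitely many v, the maximal deviation Psi is controlled by exchanging one
   observation at a time. The bounded differences inequality needs only the
   constant of the Azuma form exp(-t^2 / (2 sum c_i^2)). For E Psi, symmetrization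
   and the contraction of the hinge loss are performed together in each step,
   which produces the Rademacher average with a factor 2. The bounds do not depend on
   the finite set, so they pass to a countable dense subset of V, and then to V by
   continuity; this avoids any measurability question about the supremum over V. *)

Require Import Defs.
From HB Require Import structures.
From mathcomp Require Import all_boot all_order all_algebra.
From mathcomp Require Import all_classical all_reals all_analysis.
From mathcomp Require Import measurable_realfun ring lra.
Set Implicit Arguments.
Unset Strict Implicit.
Unset Printing Implicit Defensive.

Import Order.TTheory GRing.Theory Num.Theory.
Import numFieldNormedType.Exports.
Local Open Scope classical_set_scope.
Local Open Scope ring_scope.

(** * An elementary inequality for the exponential *)

Section ExpIneq.
Context {R : realType}.
Implicit Types x : R.

Lemma expR_double x : expR x = expR (x / 2) ^+ 2.
Proof. by rewrite expr2 -expRD; congr expR; lra. Qed.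

(* [exp (x/2) <= 1 / (1 - x/2)] gives the bound for small [x]; squaring extends it. *)
Lemma expR_quadratic_small x : 0 <= x -> x <= 4^-1 -> expR x <= 1 + x + x ^+ 2.
Proof.
move=> x0 x4; have h : 1 - x / 2 <= expR (- (x / 2)) by apply: expR_ge1Dx.
have e0 := expR_gt0 (x / 2).
have e1 : expR (x / 2) * expR (- (x / 2)) = 1 by rewrite -expRD subrr expR0.
have h2 : expR (x / 2) * (1 - x / 2) <= 1 by rewrite -[leRHS]e1 ler_wpM2l// ltW.
have h3 : expR x * (1 - x / 2) ^+ 2 <= 1.
  by rewrite expR_double -exprMn; apply: exprn_ile1 => //; apply: mulr_ge0; lra.
have q : 1 <= (1 + x + x ^+ 2) * (1 - x / 2) ^+ 2 by nra.
rewrite -(ler_pM2r (_ : 0 < (1 - x / 2) ^+ 2)); last by apply: exprn_gt0; lra.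
exact: le_trans h3 q.
Qed.

Lemma expR_quadratic_half x : 0 <= x -> x <= 2^-1 -> expR x <= 1 + x + x ^+ 2.
Proof.
move=> x0 x2; have h : expR (x / 2) <= 1 + x / 2 + (x / 2) ^+ 2.
  by apply: expR_quadratic_small; lra.
have e0 := expR_gt0 (x / 2).
have l : expR (x / 2) ^+ 2 <= (1 + x / 2 + (x / 2) ^+ 2) ^+ 2.
  by apply: lerXn2r; rewrite ?nnegrE; nra.
rewrite expR_double; apply: le_trans l _; rewrite -subr_ge0.
have -> : 1 + x + x ^+ 2 - (1 + x / 2 + (x / 2) ^+ 2) ^+ 2 =
    x ^+ 2 * (4 - 4 * x - x ^+ 2) / 16 by field.
by apply: mulr_ge0 => //; apply: mulr_ge0; nra.
Qed.

(** For [x <= 0], [exp (- x) >= 1 - x] gives [exp x <= 1 + x + x^2]. For [x > 1], [x <= x^2] is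
    enough. In between, both exponentials are squares of their values at half the argument, and
    polynomial bounds on the roots are compared. *)
Lemma expR_le_idD_expR_sqr x : expR x <= x + expR (x ^+ 2).
Proof.
have e1 : 1 + x ^+ 2 <= expR (x ^+ 2) by exact: expR_ge1Dx.
have [x0|x0] := leP x 0.
  have h : 1 - x <= expR (- x) by apply: expR_ge1Dx.
  have e0 := expR_gt0 x.
  have eN : expR x * expR (- x) = 1 by rewrite -expRD subrr expR0.
  have h2 : expR x * (1 - x) <= 1 by rewrite -[leRHS]eN ler_wpM2l// ltW.
  have : 1 <= (1 + x + x ^+ 2) * (1 - x) by nra.
  nra.
have [x1|x1] := leP x 1; last first.
  by apply: ler_wpDl; [lra|rewrite ler_expR; nra].
have h : expR (x / 2) <= 1 + x / 2 + (x / 2) ^+ 2.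
  by apply: expR_quadratic_half; lra.
have e0 := expR_gt0 (x / 2).
have h2 : 1 + x ^+ 2 / 2 <= expR (x ^+ 2 / 2) by exact: expR_ge1Dx.
rewrite (expR_double x) (expR_double (x ^+ 2)).
have l : expR (x / 2) ^+ 2 <= (1 + x / 2 + (x / 2) ^+ 2) ^+ 2 by apply: lerXn2r; rewrite ?nnegrE; nra.
have u : (1 + x ^+ 2 / 2) ^+ 2 <= expR (x ^+ 2 / 2) ^+ 2 by apply: lerXn2r; rewrite ?nnegrE; nra.
have : (1 + x / 2 + (x / 2) ^+ 2) ^+ 2 <= x + (1 + x ^+ 2 / 2) ^+ 2.
  rewrite -subr_ge0.
  have -> : x + (1 + x ^+ 2 / 2) ^+ 2 - (1 + x / 2 + (x / 2) ^+ 2) ^+ 2 =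
      x ^+ 2 * ((1 - x) * (4 - 3 * x) + 3 * x) / 16 by field.
  by apply: mulr_ge0 => //; apply: mulr_ge0; nra.
lra.
Qed.
End ExpIneq.
(** * Expectations of bounded functions and resampling of one observation *)

Section BoundedMeasurable.
Context {R : realType} {d : measure_display} {T : measurableType d}.
Implicit Types (f g : T -> R) (mu : probability T R).

(** Such functions are integrable for every probability measure. The bound holds at every point, so
    it survives freezing a variable and composition with measurable maps. *)
Definition bmf f := measurable_fun setT f /\ exists M, forall x, `|f x| <= M.

Lemma bmf_cst c : bmf (fun=> c).
Proof. by split=> //; exists `|c|. Qed.

Lemma bmfD f g : bmf f -> bmf g -> bmf (fun x => f x + g x).
Proof.
move=> [mf [M fM]] [mg [M' gM]]; split; first exact: measurable_funD.
exists (M + M') => x; apply: le_trans (ler_normD _ _) _; exact: lerD.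
Qed.

Lemma bmfZ c f : bmf f -> bmf (fun x => c * f x).
Proof.
move=> [mf [M fM]]; split; first exact: measurable_funM.
by exists (`|c| * M) => x; rewrite normrM ler_wpM2l.
Qed.

Lemma bmfN f : bmf f -> bmf (fun x => - f x).
Proof.
move=> [mf [M fM]]; split; first exact: measurableT_comp.
by exists M => x; rewrite normrN.
Qed.

Lemma bmfB f g : bmf f -> bmf g -> bmf (fun x => f x - g x).
Proof. by move=> bf bg; apply: bmfD => //; apply: bmfN. Qed.

Lemma bmf_sum (I : Type) (r : seq I) (Q : pred I) (F : I -> T -> R) :
  (forall i, Q i -> bmf (F i)) -> bmf (fun x => \sum_(i <- r | Q i) F i x).
Proof.
move=> bF; elim: r => [|i r ih].
  by under eq_fun do rewrite big_nil; exact: bmf_cst.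
under eq_fun do rewrite big_cons.
by have [Qi|//] := boolP (Q i); apply: bmfD => //; exact: bF.
Qed.

Lemma bmf_max f g : bmf f -> bmf g -> bmf (fun x => Num.max (f x) (g x)).
Proof.
move=> [mf [M fM]] [mg [M' gM]]; split; first exact: measurable_maxr.
by exists (Num.max M M') => x; rewrite /Num.max; case: ifP => _;
  case: ifPn => //; rewrite -?leNgt => H;
  do ?[exact: le_trans (gM x) _ | exact: le_trans (fM x) _];
  apply: le_trans (ltW H) || apply: (le_trans _ H).
Qed.

Lemma bmf_expR f : bmf f -> bmf (fun x => expR (f x)).
Proof.
move=> [mf [M fM]]; split; first exact: measurableT_comp.
exists (expR M) => x; rewrite ger0_norm ?expR_ge0// ler_expR.
by apply: le_trans (fM x); exact: ler_norm.
Qed.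

Lemma bmf_integrable mu f : bmf f -> mu.-integrable setT (EFin \o f).
Proof.
move=> [mf [M fM]]; apply: measurable_bounded_integrable => //.
- by apply: le_lt_trans (probability_le1 mu measurableT) _; rewrite ltry.
- exists M; split; first exact: num_real.
  by move=> x Mx y _ /=; apply: le_trans (fM y) (ltW Mx).
Qed.

Lemma bmf_EFin_Rintegral mu f : bmf f ->
  (\int[mu]_x (f x)%:E = (\int[mu]_x f x)%:E)%E.
Proof.
by move=> bf; rewrite /Rintegral fineK//; exact/integrable_fin_num/bmf_integrable.
Qed.

Lemma prob_Rintegral_cst mu c : \int[mu]_x c = c.
Proof.
rewrite Rintegral_cst// -[RHS]mulr1; congr (_ * _).
by have /(congr1 fine) := probability_setT mu.
Qed.

Lemma bmf_le mu f g : bmf f -> bmf g -> (forall x, f x <= g x) ->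
  \int[mu]_x f x <= \int[mu]_x g x.
Proof.
by move=> bf bg fg; apply: le_Rintegral => //; exact: bmf_integrable.
Qed.

Lemma bmf_integralD mu f g : bmf f -> bmf g ->
  \int[mu]_x (f x + g x) = \int[mu]_x f x + \int[mu]_x g x.
Proof. by move=> bf bg; apply: RintegralD => //; exact: bmf_integrable. Qed.

Lemma bmf_integralZ mu c f : bmf f ->
  \int[mu]_x (c * f x) = c * \int[mu]_x f x.
Proof. by move=> bf; apply: RintegralZl => //; exact: bmf_integrable. Qed.

Lemma bmf_integralB mu f g : bmf f -> bmf g ->
  \int[mu]_x (f x - g x) = \int[mu]_x f x - \int[mu]_x g x.
Proof. by move=> bf bg; apply: RintegralB => //; exact: bmf_integrable. Qed.

Lemma bmf_integral_sum mu (I : Type) (s : seq I) (F : I -> T -> R) :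
  (forall i, bmf (F i)) ->
  \int[mu]_x (\sum_(i <- s) F i x) = \sum_(i <- s) \int[mu]_x F i x.
Proof.
move=> bF; elim: s => [|i s ih].
  by under eq_Rintegral do rewrite big_nil; rewrite prob_Rintegral_cst big_nil.
under eq_Rintegral do rewrite big_cons.
by rewrite bmf_integralD// ?ih ?big_cons//; exact: bmf_sum.
Qed.

Lemma bmf_integral_bound mu f M : bmf f -> (forall x, `|f x| <= M) ->
  `|\int[mu]_x f x| <= M.
Proof.
move=> bf fM.
have lo : \int[mu]_x (- M) <= \int[mu]_x f x.
  apply: bmf_le => //; first exact: bmf_cst.
  by move=> x; have := fM x; rewrite ler_norml => /andP[].
have hi : \int[mu]_x f x <= \int[mu]_x M.
  apply: bmf_le => //; first exact: bmf_cst.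
  by move=> x; have := fM x; rewrite ler_norml => /andP[].
by move: lo hi; rewrite !prob_Rintegral_cst ler_norml => -> ->.
Qed.

End BoundedMeasurable.

Lemma bmf_comp {R : realType} {d d'} {T : measurableType d}
    {T' : measurableType d'} (f : T' -> R) (h : T -> T') :
  bmf f -> measurable_fun setT h -> bmf (fun x => f (h x)).
Proof.
move=> [mf [M fM]] mh; split; first exact: measurableT_comp.
by exists M => x; exact: fM.
Qed.

(** * Fubini's theorem for an independent pair *)

Section IndependentPair.
Context {R : realType} {d1 d2 d3 : measure_display}.
Context {Om : measurableType d1} {S : measurableType d2} {T : measurableType d3}.
Variables (P : probability Om R) (rho : probability S R).
Variables (X : Om -> S) (Y : {mfun Om >-> T}).
Hypotheses (mX : measurable_fun setT X).
Hypothesis law : forall A, measurable A -> P (X @^-1` A) = rho A.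
Hypothesis indep : forall A B, measurable A -> measurable B ->
  P (X @^-1` A `&` Y @^-1` B) = (P (X @^-1` A) * P (Y @^-1` B))%E.
Variable F : S * T -> R.
Hypothesis bF : bmf F.

Let PY : probability T R := distribution P Y.

Let mXY : measurable_fun setT (fun w => (X w, Y w)).
Proof. exact: measurable_fun_pair. Qed.

Let XY : {mfun Om >-> (S * T)%type} :=
  HB.pack (fun w => (X w, Y w)) (isMeasurableFun.Build _ _ _ _ _ mXY).

(** Independence gives equality on rectangles, and these determine a product measure. *)
Let jointE : forall C, measurable C -> (rho \x PY)%E C = distribution P XY C.
Proof.
apply: product_measure_unique => A B mA mB.
by rewrite /= /distribution /pushforward /= -law// -indep.
Qed.

Let iF : (rho \x PY)%E.-integrable setT (EFin \o F).
Proof. exact: (bmf_integrable (rho \x PY)%E bF). Qed.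

Lemma bmf_pair1 t : bmf (fun s => F (s, t)).
Proof. by apply: (bmf_comp (h := fun s => (s, t)) bF); exact: measurable_fun_pair. Qed.

Lemma bmf_pair2 s : bmf (fun t => F (s, t)).
Proof. by apply: (bmf_comp (h := fun t => (s, t)) bF); exact: measurable_fun_pair. Qed.

Lemma bmf_indep_inner2 : bmf (fun s => \int[P]_w F (s, Y w)).
Proof.
have bY s : bmf (fun w => F (s, Y w)) by apply: bmf_comp (bmf_pair2 s) _.
split; last first.
  case: bF => _ [M FM]; exists M => s; exact: bmf_integral_bound.
have := measurable_fubini_F iF; rewrite /fubini_F => mFF.
rewrite (_ : (fun s => _) = fine \o (fun s => \int[PY]_t (F (s, t))%:E)%E).
  exact: measurableT_comp.
apply/funext => s /=; rewrite /Rintegral integral_pushforward//=.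
- by case: (bmf_pair2 s) => ms _; exact/measurable_EFinP.
- exact: (bmf_integrable P (bY s)).
Qed.

Lemma bmf_indep_inner1 : bmf (fun w => \int[rho]_s F (s, Y w)).
Proof.
apply: (@bmf_comp _ _ _ _ _ (fun t => \int[rho]_s F (s, t)) Y) => //; split; last first.
  case: bF => _ [M FM]; exists M => t; exact: bmf_integral_bound (bmf_pair1 t) _.
have := measurable_fubini_G iF; rewrite /fubini_G => mFF.
rewrite (_ : (fun t => _) = fine \o (fun t => \int[rho]_s (F (s, t))%:E)%E)//.
exact: measurableT_comp.
Qed.

Let prodE : \int[P]_w F (X w, Y w) = fine (\int[rho \x PY]_z (F z)%:E)%E.
Proof.
rewrite (eq_measure_integral (distribution P XY)); last first.
  by move=> C mC _; exact: jointE.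
rewrite integral_pushforward//=; first by case: bF => mF _; exact/measurable_EFinP.
exact: (bmf_integrable P (bmf_comp bF mXY)).
Qed.

Lemma indep_integral21 :
  \int[P]_w F (X w, Y w) = \int[rho]_s \int[P]_w F (s, Y w).
Proof.
rewrite prodE -(integral12_prod_meas1 iF)/fubini_F /Rintegral; congr fine.
apply: eq_integral => s _.
have bY : bmf (fun w => F (s, Y w)) by apply: bmf_comp (bmf_pair2 s) _.
rewrite -bmf_EFin_Rintegral//= integral_pushforward//=.
- by case: (bmf_pair2 s) => ms _; exact/measurable_EFinP.
- exact: (bmf_integrable P bY).
Qed.

Lemma indep_integral12 :
  \int[P]_w F (X w, Y w) = \int[P]_w \int[rho]_s F (s, Y w).
Proof.
rewrite prodE -(integral21_prod_meas1 iF)/fubini_G /Rintegral; congr fine.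
rewrite integral_pushforward//=.
- by apply: eq_integral => w _; rewrite -bmf_EFin_Rintegral//; exact: bmf_pair1.
- exact: measurable_fubini_G iF.
- have := bmf_integrable P bmf_indep_inner1; apply: eq_integrable => // w _ /=.
  by rewrite -bmf_EFin_Rintegral//; exact: bmf_pair1.
Qed.
End IndependentPair.

(** * Separating one observation from the rest of the sample *)

Section IidSample.
Context {R : realType} {dO dZ : measure_display}.
Context {Om : measurableType dO} {Z : measurableType dZ}.
Variables (P : probability Om R) (rho : probability Z R) (m : nat).
Variables (zs : 'I_m -> Om -> Z) (hiid : iid_sample P rho zs) (i : 'I_m).

Let mzs j : measurable_fun setT (zs j). Proof. by case: hiid. Qed.

(* Om with the sigma-algebra generated by these sets carries the sample with
   the i-th observation removed; it plays the part of the product of the other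
   factors in Fubini's theorem. *)
Definition other_cylinders : set (set Om) :=
  [set C | exists2 B : 'I_m -> set Z, (forall j, measurable (B j)) /\ B i = setT
     & C = \bigcap_j (zs j @^-1` B j)].

Lemma measurable_cylinder (B : 'I_m -> set Z) : (forall j, measurable (B j)) ->
  measurable (\bigcap_j (zs j @^-1` B j)).
Proof.
move=> mB; apply: fin_bigcap_measurable => // j _.
by rewrite -[X in measurable X]setTI; exact: mzs.
Qed.

Lemma other_cylinders_measurable : other_cylinders `<=` measurable.
Proof. by move=> _ [B [mB _] ->]; exact: measurable_cylinder. Qed.

Lemma other_cylinders_setI : setI_closed other_cylinders.
Proof.
move=> _ _ [B [mB Bi] ->] [B' [mB' B'i] ->]; exists (fun j => B j `&` B' j).
  by split=> [j|]; [exact: measurableI|rewrite Bi B'i setTI].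
by rewrite -bigcapI.
Qed.

Lemma other_cylindersT : other_cylinders setT.
Proof.
exists (fun=> setT) => //.
by apply/seteqP; split=> // w _ j _.
Qed.

Let others := g_sigma_algebraType other_cylinders.

Lemma measurable_fun_others j : j != i ->
  measurable_fun (setT : set others) (zs j : others -> Z).
Proof.
move=> ji _ B mB; rewrite setTI; apply: sub_sigma_algebra.
exists (fun k => if k == j then B else setT).
  split=> [k|]; first by case: ifP.
  by rewrite eq_sym (negbTE ji).
apply/seteqP; split => [w Bw k _|w].
  by case: eqVneq => // ->.
by move=> /(_ j I); rewrite eqxx.
Qed.

Lemma measurable_fun_to_others :
  measurable_fun (setT : set Om) (idfun : Om -> others).
Proof.
move=> _ B mB; rewrite setTI.
exact: (smallest_sub (@sigma_algebra_measurable _ Om) other_cylinders_measurable).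
Qed.

(** The identity, seen as the random variable that keeps only the observations other than the
    [i]-th; it is the [Y] of the independent pair. *)
Definition to_others : {mfun Om >-> others} :=
  HB.pack (idfun : Om -> others)
    (isMeasurableFun.Build _ _ _ _ _ measurable_fun_to_others).

(** For fixed [A] both sides are finite measures in [B]. They agree on the cylinders, which are
    stable under intersection, contain the whole space and generate the sigma-algebra. *)
Lemma sample_indep_others A (B : set others) : measurable A -> measurable B ->
  P (zs i @^-1` A `&` to_others @^-1` B) =
  (P (zs i @^-1` A) * P (to_others @^-1` B))%E.
Proof.
move=> mA mB; have mzA : measurable (zs i @^-1` A).
  by rewrite -[X in measurable X]setTI; exact: mzs.
have p0 : 0 <= fine (P (zs i @^-1` A)) by exact: fine_ge0.
have pE : P (zs i @^-1` A) = (fine (P (zs i @^-1` A)))%:E.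
  by rewrite fineK//; exact: fin_num_measure.
have cover : \bigcup_(k in (setT : set nat)) (setT : set Om) = setT.
  by apply/seteqP; split=> // w _; exists 0%N.
have := @g_sigma_algebra_measure_unique _ R Om other_cylinders
  other_cylinders_measurable (fun=> setT) (fun=> other_cylindersT)
  cover (mrestr P mzA) (mscale (NngNum p0) P)
  other_cylinders_setI.
move=> H; rewrite setIC pE; apply: H => //; last first.
  move=> _; change (P (setT `&` zs i @^-1` A) < +oo)%E.
  by rewrite setTI ltey_eq fin_num_measure.
move=> _ [B' [mB' B'i] ->].
change (P (\bigcap_j (zs j @^-1` B' j) `&` zs i @^-1` A) =
  (fine (P (zs i @^-1` A)))%:E * P (\bigcap_j (zs j @^-1` B' j)))%E.
rewrite -pE.
case: hiid => _ _ indep; rewrite (indep B' mB').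
(* Slot [i] of the cylinder is free; filling it with [A] turns the intersection into a single
   cylinder of the full sample. *)
pose B'' j := if j == i then A else B' j.
have mB'' j : measurable (B'' j) by rewrite /B''; case: ifP.
have -> : \bigcap_j zs j @^-1` B' j `&` zs i @^-1` A = \bigcap_j zs j @^-1` B'' j.
  apply/seteqP; split => [w [Bw Aw] j _|w Bw].
    by rewrite /B''; case: eqVneq => [->|_] //; exact: Bw.
  split; last by have := Bw i I; rewrite /B'' eqxx.
  move=> j _; have := Bw j I; rewrite /B''; case: eqVneq => // -> _.
  by rewrite B'i.
rewrite (indep B'' mB'') (bigD1 i)//= {1}/B'' eqxx; congr (_ * _)%E.
rewrite [RHS](bigD1 i)//= B'i preimage_setT probability_setT mul1e.
by apply: eq_bigr => j ji; rewrite /B'' (negbTE ji).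
Qed.

Let lawi A : measurable A -> P (zs i @^-1` A) = rho A.
Proof. by move=> mA; case: hiid => _ law _; exact: law. Qed.

(** Measurability in the second argument is for the coarser sigma-algebra: [F z] may depend on the
    sample only through the observations other than the [i]-th, whose place is taken by [z]. *)
Definition bmf_resample (F : Z -> Om -> R) :=
  bmf ((fun p => F p.1 p.2) : Z * others -> R).

Variables (F : Z -> Om -> R).
Hypothesis bF : bmf_resample F.

Lemma bmf_resample1 : bmf (fun w => \int[rho]_z F z w).
Proof. exact: (bmf_indep_inner1 P rho to_others bF). Qed.

Lemma bmf_resample2 : bmf (fun z => \int[P]_w F z w).
Proof. exact: (bmf_indep_inner2 P rho to_others bF). Qed.

Lemma integral_resample21 :
  \int[P]_w F (zs i w) w = \int[rho]_z \int[P]_w F z w.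
Proof. exact: (indep_integral21 (mzs i) lawi sample_indep_others bF). Qed.

Lemma integral_resample12 :
  \int[P]_w F (zs i w) w = \int[P]_w \int[rho]_z F z w.
Proof. exact: (indep_integral12 (mzs i) lawi sample_indep_others bF). Qed.

End IidSample.

(** * Bounded differences, symmetrization and contraction for finite classes *)

Section FiniteMax.
Context {R : realType}.
Implicit Types (n : nat) (u v c x y : nat -> R).

(** The maximum runs over the indices from 0 to [n] inclusive, so it is never over an empty set. *)
Fixpoint mx n u : R := if n is k.+1 then Num.max (mx k u) (u n) else u 0%N.

Lemma le_mx n u k : (k <= n)%N -> u k <= mx n u.
Proof.
elim: n => [|n ih]; first by rewrite leqn0 => /eqP ->.
rewrite leq_eqVlt => /predU1P[->|kn] /=; first by rewrite le_max lexx orbT.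
by rewrite le_max ih.
Qed.

Lemma mx_attained n u : exists2 k, (k <= n)%N & mx n u = u k.
Proof.
elim: n => [|n [k kn kE]]; first by exists 0%N.
rewrite /= /Num.max; case: ifP => _; first by exists n.+1.
by exists k => //; exact: leqW.
Qed.

Lemma mx_le n u B : (forall k, u k <= B) -> mx n u <= B.
Proof. by move=> uB; have [k _ ->] := mx_attained n u. Qed.

Lemma eq_mx n u v : u =1 v -> mx n u = mx n v.
Proof. by move=> uv; congr mx; exact/funext. Qed.

Lemma mx_leD n u v e : (forall k, u k <= v k + e) -> mx n u <= mx n v + e.
Proof.
move=> uv; have [k kn ->] := mx_attained n u.
by apply: le_trans (uv k) _; rewrite lerD2r; exact: le_mx.
Qed.

Lemma mx_mid n u v w : (forall k, w k = (u k + v k) / 2) ->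
  mx n w <= (mx n u + mx n v) / 2.
Proof.
move=> wE; have [k kn ->] := mx_attained n w; rewrite wE.
by rewrite ler_pM2r ?invr_gt0// lerD// le_mx.
Qed.

(* The contraction principle for one Rademacher sign: the maximisers of the two
   terms on the left are compared with the pair of indices ordered by [y]. *)
Lemma mx_contraction n c x y : (forall k l, `|x k - x l| <= `|y k - y l|) ->
  mx n (fun k => c k + x k) + mx n (fun k => c k - x k) <=
  mx n (fun k => c k + y k) + mx n (fun k => c k - y k).
Proof.
move=> xy; have [k kn ->] := mx_attained n (fun k => c k + x k).
have [l ln ->] := mx_attained n (fun k => c k - x k).
have k1 := le_mx (fun k => c k + y k) kn; have l1 := le_mx (fun k => c k + y k) ln.
have k2 := le_mx (fun k => c k - y k) kn; have l2 := le_mx (fun k => c k - y k) ln.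
have := le_trans (ler_norm _) (xy k l).
have [ykl|ykl] := leP (y l) (y k).
- by rewrite ger0_norm ?subr_ge0//; lra.
- by rewrite ltr0_norm ?subr_lt0//; lra.
Qed.

Lemma bmf_mx d (T : measurableType d) n (u : nat -> T -> R) :
  (forall k, bmf (u k)) -> bmf (fun t => mx n (fun k => u k t)).
Proof. by move=> bu; elim: n => [|n ih] /=; [exact: bu|exact: bmf_max]. Qed.

End FiniteMax.

(** The centre is the midpoint of the range. Centring at the mean would only give the distance [c],
    and would double the exponent in the moment bound that follows. *)
Lemma bmf_half_range {R : realType} {d} {T : measurableType d} (u : T -> R) c :
  bmf u -> (forall z z', `|u z - u z'| <= c) -> exists M, forall z, `|u z - M| <= c / 2.
Proof.
move=> [_ [K uK]] uc; set A := range u.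
have A0 : A !=set0 by exists (u point), point.
have ubA : has_ubound A.
  by exists K => _ [z _ <-]; exact: le_trans (ler_norm _) (uK z).
have lbA : has_lbound A.
  by exists (- K) => _ [z _ <-]; have := uK z; rewrite ler_norml => /andP[].
have w : sup A - c <= inf A.
  apply: lb_le_inf => // _ [z _ <-]; rewrite lerBlDr; apply: ge_sup => // _ [z' _ <-].
  by rewrite -lerBlDl; exact: le_trans (ler_norm _) (uc z' z).
exists ((sup A + inf A) / 2) => z.
have h1 : u z <= sup A by apply: ub_le_sup => //; exists z.
have h2 : inf A <= u z by apply: ge_inf => //; exists z.
by rewrite ler_norml; apply/andP; split; lra.
Qed.

(* With [w = u - M] centred at mid-range and [K = exp (s^2 c^2 / 4)], integrating
   [exp x <= x + exp (x^2)] at [s w] gives at most [s E w + K], while at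
   [- s E w] it gives [exp (- s E w) <= K - s E w]; the product is at most [K^2]. *)
Lemma hoeffding_mgf {R : realType} {d} {T : measurableType d} (mu : probability T R)
    (u : T -> R) (c s : R) : bmf u -> (forall z z', `|u z - u z'| <= c) ->
  \int[mu]_z expR (s * u z) <= expR (s * \int[mu]_z u z + s ^+ 2 * c ^+ 2 / 2).
Proof.
move=> bu uc; have [M uM] := bmf_half_range bu uc.
set e := \int[mu]_z u z; set K := expR (s ^+ 2 * c ^+ 2 / 4).
pose w z := u z - M.
have bw : bmf w by apply: bmfB => //; exact: bmf_cst.
have ew : \int[mu]_z w z = e - M.
  by rewrite /w bmf_integralB ?prob_Rintegral_cst//; exact: bmf_cst.
have bound x : `|x| <= c / 2 -> expR (s * x) <= s * x + K.
  move=> xc; apply: le_trans (expR_le_idD_expR_sqr _) _; rewrite lerD2l ler_expR.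
  have : `|x| ^+ 2 <= (c / 2) ^+ 2.
    by apply: lerXn2r => //; rewrite nnegrE; apply: le_trans xc.
  rewrite real_normK ?num_real// => x2; rewrite exprMn.
  have -> : s ^+ 2 * c ^+ 2 / 4 = s ^+ 2 * (c / 2) ^+ 2 by field.
  by rewrite ler_wpM2l// sqr_ge0.
have eM : `|e - M| <= c / 2 by rewrite -ew; exact: bmf_integral_bound.
have i1 : \int[mu]_z expR (s * w z) <= s * (e - M) + K.
  rewrite -ew -bmf_integralZ// -[X in _ + X](prob_Rintegral_cst mu K).
  rewrite -bmf_integralD; [|exact: bmfZ|exact: bmf_cst].
  apply: bmf_le => [||z].
  - by apply: bmf_expR; exact: bmfZ.
  - by apply: bmfD; [exact: bmfZ|exact: bmf_cst].
  - by apply: bound; exact: uM.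
have i2 : expR (- (s * (e - M))) <= K - s * (e - M).
  by rewrite -mulrN [leRHS]addrC; apply: bound; rewrite normrN.
have -> : \int[mu]_z expR (s * u z) = expR (s * M) * \int[mu]_z expR (s * w z).
  rewrite -bmf_integralZ; last by apply: bmf_expR; exact: bmfZ.
  by apply: eq_Rintegral => z _; rewrite -expRD; congr expR; rewrite /w; ring.
have -> : s * e + s ^+ 2 * c ^+ 2 / 2 =
    s * M + (s * (e - M) + (s ^+ 2 * c ^+ 2 / 4 + s ^+ 2 * c ^+ 2 / 4)) by field.
rewrite expRD ler_wpM2l ?expR_ge0// expRD expRD -/K.
have p0 := expR_gt0 (- (s * (e - M))); have p1 := expR_gt0 (s * (e - M)).
have pE : expR (s * (e - M)) * expR (- (s * (e - M))) = 1.
  by rewrite -expRD subrr expR0.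
set q := s * (e - M) in i1 i2 p0 p1 pE *.
have i0 : 0 <= \int[mu]_z expR (s * w z) by apply: Rintegral_ge0 => z _; exact: expR_ge0.
have : (\int[mu]_z expR (s * w z)) * expR (- q) <= (q + K) * (K - q).
  by apply: ler_pM => //; exact: ltW.
move=> h; rewrite -(ler_pM2r p0); apply: le_trans h _.
have -> : expR q * (K * K) * expR (- q) = expR q * expR (- q) * (K * K) by ring.
by rewrite pE; nra.
Qed.

Section UniformDeviation.
Context {R : realType} {dO dZ : measure_display}.
Context {Om : measurableType dO} {Z : measurableType dZ}.
Variables (P : probability Om R) (rho : probability Z R) (m : nat).
Variables (zs : 'I_m -> Om -> Z) (hiid : iid_sample P rho zs) (n : nat).

Let mzs j : measurable_fun setT (zs j). Proof. by case: hiid. Qed.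

Let sum_ltS (G : 'I_m -> R) (i : 'I_m) :
  \sum_(j < m | (j < i.+1)%N) G j = G i + \sum_(j < m | (j < i)%N) G j.
Proof.
rewrite (bigD1 i)//=; congr (_ + _); apply: eq_bigl => j.
by rewrite ltnS [RHS]ltn_neqAle andbC.
Qed.

Let sum_lt0 (G : 'I_m -> R) : \sum_(j < m | (j < 0)%N) G j = 0.
Proof. by rewrite big_pred0. Qed.

Let sum_ltm (G : 'I_m -> R) : \sum_(j < m | (j < m)%N) G j = \sum_(j < m) G j.
Proof. by apply: eq_bigl => j; rewrite ltn_ord. Qed.

Let bmf_past (i : 'I_m) (G : 'I_m -> Z -> R) : (forall j, bmf (G j)) ->
  bmf ((fun p => \sum_(j < m | (j < i)%N) G j (zs j p.2)) :
         Z * g_sigma_algebraType (other_cylinders zs i) -> R).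
Proof.
move=> bG; apply: bmf_sum => j ji; apply: (bmf_comp (f := G j)
  (h := fun p : Z * g_sigma_algebraType (other_cylinders zs i) => zs j p.2)) => //.
apply: (measurableT_comp (f := (zs j : g_sigma_algebraType (other_cylinders zs i) -> Z))) => //.
by apply: measurable_fun_others; rewrite neq_ltn ji.
Qed.

(** * Bounded differences: exponential moments and tails *)

Section McDiarmid.
Variables (g : nat -> Z -> R) (c s : R).
Hypothesis bg : forall f, bmf (g f).
Hypothesis gc : forall f z z', `|g f z - g f z'| <= c.

Let h (b : nat -> R) (k : nat) (w : Om) : R :=
  mx n (fun f => b f - \sum_(j < m | (j < k)%N) g f (zs j w)).

Let bmf_h b k : bmf (h b k).
Proof.
apply: bmf_mx => f; apply: bmfB; first exact: bmf_cst.
by apply: bmf_sum => j _; exact: bmf_comp (bg f) (mzs j).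
Qed.

(* Induction on the number of variables: freezing the last one only changes the
   offsets [b]. *)
Let mgf b k : (k <= m)%N ->
  \int[P]_w expR (s * h b k w) <=
  expR (s * \int[P]_w h b k w + k%:R * (s ^+ 2 * c ^+ 2 / 2)).
Proof.
elim: k b => [|k ih] b km.
  have hE w : h b 0%N w = mx n b.
    by apply: eq_mx => f; rewrite sum_lt0 subr0.
  under eq_Rintegral do rewrite hE; under [in leRHS]eq_Rintegral do rewrite hE.
  by rewrite !prob_Rintegral_cst mul0r addr0.
pose i : 'I_m := Ordinal km.
pose F z w := h (fun f => b f - g f z) k w.
have hE w : h b k.+1 w = F (zs i w) w.
  by apply: eq_mx => f; rewrite (sum_ltS _ i); ring.
have bF : bmf_resample zs i F.
  apply: (bmf_mx n (u := fun f p => _)) => f; apply: bmfB.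
    apply: bmfB; first exact: bmf_cst.
    exact: bmf_comp (bg f) _.
  exact: (@bmf_past i (fun=> g f)).
have bE : bmf_resample zs i (fun z w => expR (s * F z w)).
  by apply: bmf_expR; exact: bmfZ.
pose u z := \int[P]_w F z w.
have bu : bmf u by have := bmf_resample2 hiid bF.
have uc z z' : `|u z - u z'| <= c.
  have le1 y y' : u y <= u y' + c.
    rewrite -[X in _ + X](prob_Rintegral_cst P) -bmf_integralD; [|exact: bmf_h|exact: bmf_cst].
    apply: bmf_le; [exact: bmf_h|apply: bmfD; [exact: bmf_h|exact: bmf_cst]|].
    move=> w; apply: mx_leD => f; have := le_trans (ler_norm _) (gc f y' y); lra.
  by rewrite ler_norml; apply/andP; split; have := le1 z z'; have := le1 z' z; lra.
under eq_Rintegral do rewrite hE; under [in leRHS]eq_Rintegral do rewrite hE.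
rewrite (integral_resample21 hiid bE) (integral_resample21 hiid bF) -/u.
set C := s ^+ 2 * c ^+ 2 / 2.
have bEu : bmf (fun z => expR (s * u z)) by apply: bmf_expR; exact: bmfZ.
(* For each value of the last observation the induction hypothesis contributes [k] times [C];
   Hoeffding's bound for [u] contributes the remaining [C]. *)
apply: (@le_trans _ _ (\int[rho]_z (expR (k%:R * C) * expR (s * u z)))).
  apply: bmf_le; [by have := bmf_resample2 hiid bE|exact: bmfZ|move=> z].
  by apply: le_trans (ih _ (ltnW km)) _; rewrite -expRD addrC.
rewrite bmf_integralZ//.
have -> : s * \int[rho]_z u z + k.+1%:R * C = k%:R * C + (s * \int[rho]_z u z + C).
  by rewrite -natr1; ring.
by rewrite expRD ler_wpM2l ?expR_ge0//; exact: hoeffding_mgf.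
Qed.

(** Chernoff's method: the indicator of the event is at most [exp (s (H - B - t))]. The parameter
    [s] stays free, to be optimised by the caller. *)
Lemma mx_deviation_tail (b : nat -> R) (B t : R) :
  0 <= s ->
  \int[P]_w mx n (fun f => b f - \sum_j g f (zs j w)) <= B ->
  (P [set w | (B + t < mx n (fun f => b f - \sum_j g f (zs j w)))%R] <=
  (expR (m%:R * (s ^+ 2 * c ^+ 2 / 2) - s * t))%:E)%E.
Proof.
move=> s0.
pose H w := mx n (fun f => b f - \sum_j g f (zs j w)).
have HE : H = h b m by apply/funext => w; apply: eq_mx => f; rewrite sum_ltm.
have bH : bmf H by rewrite HE.
rewrite -/H => HB.
set A := [set w | _].
have mA : measurable A.
  rewrite -[X in measurable X]setTI; have [mH _] := bH.
  rewrite (_ : A = H @^-1` `]B + t, +oo[); first exact: mH.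
  by apply/seteqP; split=> w /=; rewrite in_itv/= andbT.
have b1 : bmf (\1_A : Om -> R).
  split; first exact: measurable_indic.
  by exists 1 => w; rewrite indicE; case: (_ \in _); rewrite ?normr1 ?normr0.
have bE : bmf (fun w => expR (s * H w)) by apply: bmf_expR; exact: bmfZ.
have PAE : (P A = (\int[P]_w (\1_A w : R))%:E)%E.
  rewrite -bmf_EFin_Rintegral// integral_indic ?setIT//.
rewrite PAE lee_fin.
apply: (@le_trans _ _ (\int[P]_w (expR (- (s * (B + t))) * expR (s * H w)))).
  apply: bmf_le; [by []|exact: bmfZ|move=> w].
  rewrite indicE -expRD; have [|_] := boolP (w \in A); last exact: expR_ge0.
  rewrite inE /A/= => Aw; rewrite -{1}expR0 ler_expR.
  by rewrite addrC -mulrBr mulr_ge0// subr_ge0 ltW.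
rewrite bmf_integralZ//.
have -> : expR (m%:R * (s ^+ 2 * c ^+ 2 / 2) - s * t) = expR (- (s * (B + t))) *
    expR (s * B + m%:R * (s ^+ 2 * c ^+ 2 / 2)).
  by rewrite -expRD; congr expR; ring.
rewrite ler_wpM2l ?expR_ge0//.
have := mgf b (leqnn m); rewrite -HE => h1; apply: le_trans h1 _.
by rewrite ler_expR lerD2r ler_wpM2l.
Qed.
End McDiarmid.

(** * Symmetrization and contraction, one observation at a time *)

Section Symmetrization.
Variables (a : nat -> Z -> R) (phi : R -> R).
Hypothesis ba : forall f, bmf (a f).
Hypothesis bphi : forall f, bmf (fun z => phi (a f z)).
Hypothesis phi_lip : forall x y, `|phi x - phi y| <= `|x - y|.

Let g f z := phi (a f z).
Let gm f := \int[rho]_z g f z.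

Let bg f : bmf (g f). Proof. exact: bphi. Qed.

(** The argument [c + gm - g] is the midpoint of [c + 2 gm] and [c - 2 g], which splits the maximum
    in two. Jensen's inequality replaces [gm] by [g] in the first half. As the halves are integrated
    separately, the same [z] serves in both, and the contraction then replaces the loss by [a]
    pointwise. *)
Let symmetrize_one (c : nat -> R) :
  \int[rho]_z mx n (fun f => c f + gm f - g f z) <=
  \int[rho]_z ((mx n (fun f => c f + 2 * a f z) + mx n (fun f => c f - 2 * a f z)) / 2).
Proof.
have bp (x : nat -> Z -> R) : (forall f, bmf (x f)) ->
    bmf (fun z => mx n (fun f => c f + 2 * x f z)).
  move=> bx; apply: (bmf_mx n (u := fun f z => c f + 2 * x f z)) => f.
  by apply: bmfD; [exact: bmf_cst|exact: bmfZ].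
have bn (x : nat -> Z -> R) : (forall f, bmf (x f)) ->
    bmf (fun z => mx n (fun f => c f - 2 * x f z)).
  move=> bx; apply: (bmf_mx n (u := fun f z => c f - 2 * x f z)) => f.
  by apply: bmfB; [exact: bmf_cst|exact: bmfZ].
have half (x y : Z -> R) : bmf x -> bmf y -> bmf (fun z => (x z + y z) / 2).
  by move=> bx by_; under eq_fun do rewrite mulrC; apply: bmfZ; exact: bmfD.
have jensen : mx n (fun f => c f + 2 * gm f) <= \int[rho]_z mx n (fun f => c f + 2 * g f z).
  have [k kn ->] := mx_attained n (fun f => c f + 2 * gm f).
  rewrite -{1}(prob_Rintegral_cst rho (c k)) /gm -bmf_integralZ//.
  rewrite -bmf_integralD; [|exact: bmf_cst|exact: bmfZ].
  apply: bmf_le; [apply: bmfD; [exact: bmf_cst|exact: bmfZ]|exact: bp|].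
  by move=> z; exact: (le_mx (fun f => c f + 2 * g f z)).
have bl : bmf (fun z => mx n (fun f => c f + gm f - g f z)).
  apply: (bmf_mx n (u := fun f z => c f + gm f - g f z)) => f.
  by apply: bmfB; [exact: bmf_cst|exact: bphi].
apply: (@le_trans _ _ (\int[rho]_z ((mx n (fun f => c f + 2 * gm f) +
    mx n (fun f => c f - 2 * g f z)) / 2))).
  apply: bmf_le => //; first by apply: half; [exact: bmf_cst|exact: bn].
  by move=> z; apply: mx_mid => f; field.
apply: (@le_trans _ _ (\int[rho]_z ((mx n (fun f => c f + 2 * g f z) +
    mx n (fun f => c f - 2 * g f z)) / 2))).
  under eq_Rintegral do rewrite mulrC; under [in leRHS]eq_Rintegral do rewrite mulrC.
  rewrite !bmf_integralZ; try by apply: bmfD; do ?[exact: bmf_cst|exact: bp|exact: bn].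
  rewrite ler_wpM2l ?invr_ge0// !bmf_integralD; do ?[exact: bmf_cst|exact: bp|exact: bn].
  by rewrite lerD2r prob_Rintegral_cst.
apply: bmf_le; [by apply: half; [exact: bp|exact: bn]..|move=> z].
rewrite ler_pM2r ?invr_gt0//.
by apply: mx_contraction => k l; rewrite -!mulrBr !normrM ler_wpM2l//; exact: phi_lip.
Qed.

Local Notation signs := {ffun 'I_m -> bool}.

Let flip (i : 'I_m) (s : signs) : signs := [ffun j => if j == i then ~~ s j else s j].

Let flipK i : involutive (flip i).
Proof.
by move=> s; apply/ffunP => j; rewrite !ffunE; case: eqP => // _; exact: negbK.
Qed.

Let rad b k w (s : signs) f : R :=
  b f + \sum_(j < m | (j < k)%N) 2 * rsign (s j) * a f (zs j w).

(** Flipping the [i]-th sign permutes the sign vectors and leaves [rad b i] unchanged, since that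
    sum stops before [i]. Hence the average over both values of this sign is already contained in
    the average over [s]. *)
Let avg_flip (i : 'I_m) b w z :
  \sum_(s : signs) (mx n (fun f => rad b i w s f + 2 * a f z) +
                    mx n (fun f => rad b i w s f - 2 * a f z)) / 2 =
  \sum_(s : signs) mx n (fun f => rad b i w s f + 2 * rsign (s i) * a f z).
Proof.
pose H s := mx n (fun f => rad b i w s f + 2 * rsign (s i) * a f z).
have radf s : rad b i w (flip i s) = rad b i w s.
  apply/funext => f; congr (_ + _); apply: eq_bigr => j ji.
  by rewrite ffunE; case: eqVneq ji => [->|//]; rewrite ltnn.
have Hflip s : mx n (fun f => rad b i w s f + 2 * a f z) +
    mx n (fun f => rad b i w s f - 2 * a f z) = H s + H (flip i s).
  rewrite /H radf ffunE eqxx; case: (s i); rewrite /rsign /=.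
    by congr (_ + _); apply: eq_mx => f; ring.
  by rewrite addrC; congr (_ + _); apply: eq_mx => f; ring.
have -> : \sum_s H s = (\sum_s H s + \sum_s H (flip i s)) / 2.
  have <- : \sum_s H s = \sum_s H (flip i s).
    by rewrite (reindex_inj (inv_inj (flipK i))).
  by field.
by rewrite -big_split mulr_suml; apply: eq_bigr => s _; rewrite Hflip.
Qed.

Let avg (H : signs -> R) : R := (2 ^ m)%:R^-1 * \sum_s H s.

Let bmf_avg d (T : measurableType d) (H : signs -> T -> R) :
  (forall s, bmf (H s)) -> bmf (fun t => avg (H^~ t)).
Proof. by move=> bH; apply: bmfZ; exact: bmf_sum. Qed.

(** Induction on [k], with general offsets [b]. With the last observation fixed, its term joins the
    offsets and the hypothesis symmetrizes the earlier ones; with the earlier observations and signs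
    fixed, [symmetrize_one] treats the last one. *)
Let symm b k : (k <= m)%N ->
  \int[P]_w mx n (fun f => b f + \sum_(j < m | (j < k)%N) (gm f - g f (zs j w))) <=
  \int[P]_w avg (fun s => mx n (rad b k w s)).
Proof.
elim: k b => [|k ih] b km.
  rewrite le_eqVlt; apply/orP; left; apply/eqP/eq_Rintegral => w _.
  rewrite (eq_mx n (v := b)); last by move=> f; rewrite sum_lt0 addr0.
  (* The average is over all [2 ^ m] sign vectors at every stage; signs of index at least [k] do not
     enter [rad b k]. *)
  rewrite /avg (eq_bigr (fun=> mx n b)); last first.
    by move=> s _; apply: eq_mx => f; rewrite /rad sum_lt0 addr0.
  rewrite sumr_const card_ffun card_bool card_ord -[mx n b *+ _]mulr_natl mulrA mulVf ?mul1r//.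
pose i : 'I_m := Ordinal km.
pose b' z f := b f + gm f - g f z.
pose F1 z w := mx n (fun f => b' z f + \sum_(j < m | (j < k)%N) (gm f - g f (zs j w))).
pose F2 z w := avg (fun s => mx n (rad (b' z) k w s)).
pose F3 z w := avg (fun s => mx n (fun f => rad b k w s f + 2 * rsign (s i) * a f z)).
have bb' f : bmf_resample zs i (fun z _ => b' z f).
  apply: bmfB; first exact: bmf_cst.
  exact: (bmf_comp (bphi f)).
have brad f s b0 : bmf_resample zs i (fun z _ => b0 z f) ->
    bmf_resample zs i (fun z w => rad (b0 z) k w s f).
  move=> bb0; apply: bmfD => //.
  by apply: (@bmf_past i (fun j z => 2 * rsign (s j) * a f z)) => j; exact: bmfZ.
have bF1 : bmf_resample zs i F1.
  apply: (bmf_mx n (u := fun f p => _)) => f; apply: bmfD => //; first exact: bb'.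
  apply: (@bmf_past i (fun j z => gm f - g f z)) => j.
  by apply: bmfB; [exact: bmf_cst|exact: bphi].
have bF2 : bmf_resample zs i F2.
  apply: (bmf_avg (H := fun s p => _)) => s; apply: (bmf_mx n (u := fun f p => _)) => f.
  by apply: brad; exact: bb'.
have bF3 : bmf_resample zs i F3.
  apply: (bmf_avg (H := fun s p => _)) => s; apply: (bmf_mx n (u := fun f p => _)) => f.
  apply: bmfD; first by apply: (brad f s (fun=> b)); exact: bmf_cst.
  by apply: bmfZ; exact: bmf_comp (ba f) _.
under eq_Rintegral => w _.
  rewrite (eq_mx n (v := fun f => b' (zs i w) f +
      \sum_(j < m | (j < k)%N) (gm f - g f (zs j w)))).
    over.
  by move=> f; rewrite (sum_ltS _ i) /b'; ring.
under [in leRHS]eq_Rintegral => w _.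
  rewrite (_ : avg _ = F3 (zs i w) w).
    over.
  congr (_ * _); apply: eq_bigr => s _; apply: eq_mx => f.
  by rewrite /rad (sum_ltS _ i); ring.
rewrite -/(F1 _ _).
(* The new observation is integrated outermost to apply the induction hypothesis, then innermost to
   apply [symmetrize_one]. *)
apply: (@le_trans _ _ (\int[P]_w \int[rho]_z F2 z w)).
  rewrite (integral_resample21 hiid bF1) -(integral_resample12 hiid bF2).
  rewrite (integral_resample21 hiid bF2).
  apply: bmf_le; [by have := bmf_resample2 hiid bF1|by have := bmf_resample2 hiid bF2|].
  by move=> z; apply: ih; exact: ltnW.
rewrite (integral_resample12 hiid bF3).
apply: bmf_le; [by have := bmf_resample1 hiid bF2|by have := bmf_resample1 hiid bF3|].
move=> w; pose C s f := rad b k w s f.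
have bC s : bmf (fun z => mx n (fun f => C s f + gm f - g f z)).
  apply: (bmf_mx n (u := fun f z => C s f + gm f - g f z)) => f.
  by apply: bmfB; [exact: bmf_cst|exact: bg].
have bD s : bmf (fun z => (mx n (fun f => C s f + 2 * a f z) +
    mx n (fun f => C s f - 2 * a f z)) / 2).
  under eq_fun do rewrite mulrC; apply: bmfZ; apply: bmfD.
    apply: (bmf_mx n (u := fun f z => C s f + 2 * a f z)) => f.
    by apply: bmfD; [exact: bmf_cst|exact: bmfZ].
  apply: (bmf_mx n (u := fun f z => C s f - 2 * a f z)) => f.
  by apply: bmfB; [exact: bmf_cst|exact: bmfZ].
have -> : \int[rho]_z F2 z w =
    avg (fun s => \int[rho]_z mx n (fun f => C s f + gm f - g f z)).
  rewrite /F2 /avg bmf_integralZ; last first.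
    by apply: bmf_sum => s _; apply: (eq_ind _ bmf (bC s)); apply/funext => z;
      apply: eq_mx => f; rewrite /C /rad /b'; ring.
  rewrite bmf_integral_sum; last first.
    by move=> s; apply: (eq_ind _ bmf (bC s)); apply/funext => z;
      apply: eq_mx => f; rewrite /C /rad /b'; ring.
  congr (_ * _); apply: eq_bigr => s _; apply: eq_Rintegral => z _.
  by apply: eq_mx => f; rewrite /C /rad /b'; ring.
have -> : \int[rho]_z F3 z w = avg (fun s => \int[rho]_z
    ((mx n (fun f => C s f + 2 * a f z) + mx n (fun f => C s f - 2 * a f z)) / 2)).
  rewrite /avg -bmf_integral_sum// -bmf_integralZ; last exact: bmf_sum.
  by apply: eq_Rintegral => z _; rewrite (avg_flip i).
rewrite /avg ler_wpM2l ?invr_ge0//; apply: ler_sum => s _.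
exact: symmetrize_one.
Qed.

Lemma symmetrization_contraction :
  \int[P]_w mx n (fun f => \sum_j (gm f - g f (zs j w))) <=
  \int[P]_w ((2 ^ m)%:R^-1 * \sum_(s : {ffun 'I_m -> bool})
     mx n (fun f => 2 * \sum_j rsign (s j) * a f (zs j w))).
Proof.
have := symm (fun=> 0) (leqnn m).
under eq_Rintegral => w _.
  rewrite (eq_mx n (v := fun f => \sum_j (gm f - g f (zs j w)))).
    over.
  by move=> f; rewrite add0r sum_ltm.
move=> h; apply: le_trans h _; rewrite le_eqVlt; apply/orP; left; apply/eqP.
apply: eq_Rintegral => w _; congr (_ * _); apply: eq_bigr => s _; apply: eq_mx => f.
by rewrite /rad add0r sum_ltm mulr_sumr; apply: eq_bigr => j _; rewrite mulrA.
Qed.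
End Symmetrization.
End UniformDeviation.

(** * Dual norms and the hypothesis class *)

Section DualNorm.
Context {R : realType}.

Lemma normr_entry m n (A : 'M[R]_(m, n)) i j : `|A i j| <= `|A|.
Proof.
have -> : `|A| = mx_norm A by [].
rewrite mx_normrE.
exact: (le_bigmax _ (fun p : 'I_m * 'I_n => `|A p.1 p.2|) (i, j)).
Qed.

Section MatrixNorm.
Context {d : nat} (N : 'M[R]_d -> R) (hN : is_matrix_norm N).
Implicit Types A B : 'M[R]_d.

Let ND A B : N (A + B) <= N A + N B. Proof. by case: hN. Qed.
Let NZ (a : R) A : N (a *: A) = `|a| * N A. Proof. by case: hN. Qed.

Lemma matrix_norm0 : N 0 = 0.
Proof. by rewrite -(scale0r 0) NZ normr0 mul0r. Qed.

Lemma matrix_normN A : N (- A) = N A.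
Proof. by rewrite -scaleN1r NZ normrN1 mul1r. Qed.

Lemma matrix_norm_ge0 A : 0 <= N A.
Proof. by have := ND A (- A); rewrite subrr matrix_norm0 matrix_normN; lra. Qed.

Lemma matrix_norm_sum (I : Type) (r : seq I) (F : I -> 'M[R]_d) :
  N (\sum_(i <- r) F i) <= \sum_(i <- r) N (F i).
Proof.
elim: r => [|i r ih]; first by rewrite !big_nil matrix_norm0.
by rewrite !big_cons; apply: le_trans (ND _ _) _; rewrite lerD2l.
Qed.

(** The norm is carried over to row vectors, where compactness and the extreme value theorem
    apply. *)
Let f (v : 'rV[R]_(d * d)) : R := N (vec_mx v).

Let fK := \sum_(k < d * d) f (delta_mx 0 k).

Let f_le v : f v <= `|v| * fK.
Proof.
rewrite /f {1}(row_sum_delta v) linear_sum mulr_sumr.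
apply: le_trans (matrix_norm_sum _ _) _; apply: ler_sum => k _.
rewrite linearZ /= NZ ler_wpM2r ?matrix_norm_ge0//; exact: normr_entry.
Qed.

Let f_continuous : continuous f.
Proof.
have fK0 : 0 <= fK by apply: sumr_ge0 => k _; exact: matrix_norm_ge0.
have lip v w : f v - f w <= `|v - w| * fK.
  rewrite lerBlDl; apply: le_trans (lerD (lexx _) (f_le _)).
  by rewrite /f -{1}(subrKC w v) linearD; exact: ND.
have near_f v e : 0 < e -> \forall w \near v, `|f v - f w| < e.
  move=> e0; have e1 : 0 < e / (fK + 1) by rewrite divr_gt0// ltr_wpDl.
  apply/nbhs_normP; exists (e / (fK + 1)) => //= w vw.
  have vwK : `|v - w| * fK < e.
    apply: (@le_lt_trans _ _ (`|v - w| * (fK + 1))); first by rewrite ler_wpM2l// lerDl.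
    by rewrite -ltr_pdivlMr// ltr_wpDl.
  have := lip v w; have := lip w v; rewrite distrC => h1 h2.
  by rewrite ltr_norml; apply/andP; split; lra.
move=> v; exact: (proj2 (@cvgrPdist_lt R _ _ (nbhs v) (nbhs_filter v) f (f v)) (near_f v)).
Qed.

(** Equivalence of norms in finite dimension: [N] has a positive minimum on the compact unit sphere
    of the sup-norm, and [C] is its inverse. *)
Lemma entry_le_matrix_norm : exists2 C, 0 <= C & forall A i j, `|A i j| <= C * N A.
Proof.
pose S := [set v : 'rV[R]_(d * d) | `|v| = 1].
have unit_vec v : v != 0 -> S (`|v|^-1 *: v).
  by move=> v0; rewrite /S /= normrZ normfV normr_id mulVf ?normr_eq0.
(* The sphere is empty when [d = 0]; the only matrix is then zero. *)
have [S0|S0] := pselect (S !=set0); last first.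
  exists 0 => // A i j; rewrite mul0r.
  have [A0|A0] := eqVneq (mxvec A) 0; last first.
    by exfalso; apply: S0; exists (`|mxvec A|^-1 *: mxvec A); exact: unit_vec.
  by rewrite -(mxvecE A) A0 mxE normr0.
have cS : compact S.
  apply: bounded_closed_compact.
    by exists 1; split=> [|x x1 v /= ->]; [exact: num_real|exact: ltW].
  have -> : S = (fun v : 'rV[R]_(d * d) => `|v|) @^-1` [set 1] by [].
  by apply: preimage_closed => // v _; exact: norm_continuous.
have [v0 v0S fmin] := EVT_min_rV S0 cS (continuous_subspaceT f_continuous).
rewrite inE in v0S.
have f0 : 0 < f v0.
  rewrite lt_neqAle matrix_norm_ge0 andbT eq_sym; apply/eqP => fv0.
  have vv0 : vec_mx v0 = 0 by case: hN => _ _; exact.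
  have v00 : v0 = 0 by rewrite -(vec_mxK v0) vv0 linear0.
  by move: v0S; rewrite /S /= v00 normr0 => /eqP; rewrite eq_sym oner_eq0.
exists (f v0)^-1; first by rewrite invr_ge0 ltW.
move=> A i j; rewrite -(mxvecE A); apply: le_trans (normr_entry _ _ _) _.
have [->|A0] := eqVneq (mxvec A) 0.
  by rewrite normr0 mulr_ge0// ?matrix_norm_ge0// invr_ge0 ltW.
have nA : 0 < `|mxvec A| by rewrite normr_gt0.
have := fmin _ (mem_set (unit_vec _ A0)).
rewrite /f linearZ /= mxvecK NZ normfV normr_id => h.
by rewrite ler_pdivlMl// mulrC -ler_pdivlMl.
Qed.

(** Since [sup] takes the value 0 on sets without a supremum, the dual norm dominates the pairings
    only once the unit ball of [N] is known to be bounded entrywise. *)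
Lemma dual_norm_bounds : exists2 C, 0 <= C & forall B,
  (forall A, N A <= 1 -> \tr (B^T *m A) <= dual_norm N B) /\
  dual_norm N B <= C * \sum_i \sum_j `|B i j|.
Proof.
have [C C0 hC] := entry_le_matrix_norm; exists C => // B.
have ub A : N A <= 1 -> \tr (B^T *m A) <= C * \sum_i \sum_j `|B i j|.
  move=> A1; apply: le_trans (ler_norm _) _; rewrite /mxtrace.
  under eq_bigr do rewrite mxE.
  rewrite exchange_big mulr_sumr /=; apply: le_trans (ler_norm_sum _ _ _) _.
  apply: ler_sum => i _; rewrite mulr_sumr; apply: le_trans (ler_norm_sum _ _ _) _.
  apply: ler_sum => j _; rewrite mxE normrM mulrC ler_wpM2r//.
  by apply: le_trans (hC _ _ _) _; rewrite ler_piMr.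
split=> [A A1|].
  by apply: ub_le_sup; [exists (C * \sum_i \sum_j `|B i j|) => _ [A' A'1 <-]; exact: ub|exists A].
apply: ge_sup; first by exists (\tr (B^T *m 0)), 0 => //=; rewrite matrix_norm0.
by move=> _ [A A1 <-]; exact: ub.
Qed.

Lemma dual_norm_ge0 B : 0 <= dual_norm N B.
Proof.
have [C _ /(_ B)[h _]] := dual_norm_bounds.
have := h 0; rewrite matrix_norm0 mulmx0 mxtrace0; exact.
Qed.

Lemma dual_norm_pairing A B t : 0 < t -> N A <= t ->
  `|\tr (B^T *m A)| <= dual_norm N B * t.
Proof.
move=> t0 At.
have one A' : N A' <= t -> \tr (B^T *m A') <= dual_norm N B * t.
  move=> A't; have [C _ /(_ B)[h _]] := dual_norm_bounds.
  rewrite -ler_pdivrMr// mulrC.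
  have nA' : N (t^-1 *: A') <= 1 by rewrite NZ normfV (gtr0_norm t0) ler_pdivrMl// mulr1.
  by have := h _ nA'; rewrite -scalemxAr mxtraceZ.
rewrite ler_norml (one A At) andbT lerNl -raddfN -mulmxN.
by apply: one; rewrite matrix_normN.
Qed.

End MatrixNorm.
End DualNorm.

(** An empty or unbounded set is covered by the default value 0 of [sup]. *)
Lemma sup_set_ge0 {R : realType} (A : set R) : (forall x, A x -> 0 <= x) -> 0 <= sup A.
Proof.
move=> A0; have [[[x Ax] ubA]|nA] := pselect (has_sup A); last by rewrite sup_out.
by apply: le_trans (A0 _ Ax) _; exact: ub_le_sup.
Qed.

(** * The class of linear forms and its Rademacher bound *)

Section KernelClass.
Context {R : realType} {d : nat}.
Variables (N : 'M[R]_d -> R) (hN : is_matrix_norm N).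
Variables (X : set 'cV[R]_d) (hX : bounded_set X) (r lambda : R).
Hypotheses (hr : 0 < r) (hl : 0 < lambda).

Definition dotp (v x : 'cV[R]_d) : R := \sum_k v k 0 * x k 0.

(* The functions learned by the algorithm are among the linear forms [dotp v] with
   [v] in this set, which does not depend on the sample. *)
Definition kernel_vectors : set 'cV[R]_d :=
  [set v | exists (m : nat) (A : 'M[R]_d) (u : 'I_m -> 'cV[R]_d) (al : 'I_m -> R),
    [/\ symmetric_mx A, N A <= lambda^-1, \sum_j `|al j| <= r^-1,
        (forall j, X (u j)) & v = \sum_j al j *: (A^T *m u j)]].

(** Symmetry of [A] exchanges [u] and [x], so that the outer product has the data point on the left,
    as in [rad_sup]. *)
Lemma KAE (A : 'M[R]_d) u x : symmetric_mx A -> KA A u x = \tr ((x *m u^T)^T *m A).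
Proof.
move=> sA; rewrite trmx_mul trmxK -mulmxA mxtrace_mulC /KA.
have -> : x^T *m A *m u = (u^T *m A *m x)^T.
  by rewrite !trmx_mul trmxK mulmxA sA.
by rewrite trace_mx11 [RHS]mxE.
Qed.

Lemma KA_dotp (A : 'M[R]_d) u x : KA A u x = dotp (A^T *m u) x.
Proof.
rewrite /KA mxE; apply: eq_bigr => k _; congr (_ * _).
by rewrite -[in RHS](trmxK u) -trmx_mul [RHS]mxE.
Qed.

Lemma kfun_dotp m (A : 'M[R]_d) (u : 'I_m -> 'cV[R]_d) al x :
  kfun A u al x = dotp (\sum_j al j *: (A^T *m u j)) x.
Proof.
rewrite /kfun /dotp; under eq_bigr do rewrite KA_dotp /dotp mulr_sumr.
rewrite exchange_big; apply: eq_bigr => k _ /=; rewrite summxE mulr_suml.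
by apply: eq_bigr => j _; rewrite mulrA; congr (_ * _); rewrite [RHS]mxE.
Qed.

Let bX : exists2 M : R, 0 <= M & forall x k, X x -> `|x k 0| <= M.
Proof.
have [M [_ hM]] := hX; exists (`|M| + 1) => [|x k Xx]; first by rewrite addr_ge0.
apply: le_trans (normr_entry _ _ _) _; apply: hM => //.
by rewrite (le_lt_trans (ler_norm M))// ltrDl.
Qed.

Lemma dotp_bounded : exists2 K : R, 0 <= K & forall x, X x -> \sum_k `|x k 0| <= K.
Proof.
have [M M0 hM] := bX; exists (\sum_(k < d) M) => [|x Xx]; first exact: sumr_ge0.
by apply: ler_sum => k _; exact: hM.
Qed.

Lemma dual_norm_outer_bounded : exists M, forall x x' : 'cV[R]_d, X x -> X x' ->
  dual_norm N (x' *m x^T) <= M.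
Proof.
have [M M0 hM] := bX; have [C C0 hC] := dual_norm_bounds hN.
exists (C * \sum_(i < d) \sum_(j < d) (M * M)) => x x' Xx Xx'.
have [_ h] := hC (x' *m x^T); apply: le_trans h _.
rewrite ler_wpM2l//; apply: ler_sum => i _; apply: ler_sum => j _.
by rewrite mxE big_ord1 mxE normrM ler_pM// hM.
Qed.

Lemma dual_norm_le_Xstar x x' : X x -> X x' -> dual_norm N (x' *m x^T) <= Xstar N X.
Proof.
move=> Xx Xx'; have [M hM] := dual_norm_outer_bounded.
apply: ub_le_sup; last by exists x, x'.
by exists M => _ [y [y' [Xy Xy' ->]]]; exact: hM.
Qed.

Lemma Xstar_ge0 : 0 <= Xstar N X.
Proof.
apply: sup_set_ge0 => _ [x [x' [_ _ ->]]]; exact: dual_norm_ge0.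
Qed.

Lemma weighted_sum_bound m (al t : 'I_m -> R) B : 0 <= B ->
  \sum_j `|al j| <= r^-1 -> (forall j, `|t j| <= B * lambda^-1) ->
  `|\sum_j al j * t j| <= (lambda * r)^-1 * B.
Proof.
move=> B0 sal tB; apply: le_trans (ler_norm_sum _ _ _) _.
apply: (@le_trans _ _ (\sum_j `|al j| * (B * lambda^-1))).
  by apply: ler_sum => j _; rewrite normrM ler_wpM2l.
have -> : (lambda * r)^-1 * B = r^-1 * (B * lambda^-1) by rewrite invfM; ring.
by rewrite -mulr_suml ler_wpM2r// mulr_ge0// invr_ge0 ltW.
Qed.

Lemma dotp_kernel_bound v x : kernel_vectors v -> X x ->
  `|dotp v x| <= (lambda * r)^-1 * Xstar N X.
Proof.
move=> [m [A [u [al [sA NA sal Xu ->]]]]] Xx; rewrite -kfun_dotp.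
apply: weighted_sum_bound => // [|j]; first exact: Xstar_ge0.
rewrite KAE//; apply: le_trans (dual_norm_pairing hN _ _ NA) _.
  by rewrite invr_gt0.
apply: ler_wpM2r; first by rewrite invr_ge0 ltW.
exact: dual_norm_le_Xstar.
Qed.

Section Sample.
Context {m : nat} (hm : (0 < m)%N).
Variables (xs : 'I_m -> 'cV[R]_d) (ys : 'I_m -> R).
Hypothesis hxs : forall i, X (xs i).

Lemma dual_norm_le_rad_sup (s : {ffun 'I_m -> bool}) xt : X xt ->
  dual_norm N ((m%:R)^-1 *: \sum_(i < m) (rsign (s i) * ys i) *: (xs i *m xt^T))
  <= rad_sup N X xs ys s.
Proof.
move=> Xxt; apply: ub_le_sup; last by exists xt.
have [M M0 hM] := bX; have [C C0 hC] := dual_norm_bounds hN.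
pose K := `|(m%:R)^-1 : R| * \sum_(i < m) `|rsign (s i) * ys i| * (M * M).
exists (C * \sum_(i < d) \sum_(j < d) K) => _ [x Xx <-].
set B := _ *: _; have [_ h] := hC B; apply: le_trans h _.
rewrite ler_wpM2l//; apply: ler_sum => i _; apply: ler_sum => j _.
rewrite mxE normrM summxE ler_wpM2l//; apply: le_trans (ler_norm_sum _ _ _) _.
apply: ler_sum => k _; rewrite mxE normrM ler_wpM2l//.
by rewrite mxE big_ord1 mxE normrM ler_pM// hM.
Qed.

Lemma rad_sup_ge0 s : 0 <= rad_sup N X xs ys s.
Proof. by apply: sup_set_ge0 => _ [x _ <-]; exact: dual_norm_ge0. Qed.

(** After exchanging the sums over sample points and over centres, the centre [u j] contributes the
    pairing of [A] with the signed matrix [B j], which is the one in [rad_sup] at [xt = u j].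
    Duality of norms and the l1 bound on the coefficients finish. *)
Lemma rademacher_kernel_bound v (s : {ffun 'I_m -> bool}) : kernel_vectors v ->
  \sum_i rsign (s i) * (ys i * dotp v (xs i)) <=
  m%:R * ((lambda * r)^-1 * rad_sup N X xs ys s).
Proof.
move=> [n [A [u [al [sA NA sal Xu ->]]]]].
pose B j := (m%:R)^-1 *: \sum_(i < m) (rsign (s i) * ys i) *: (xs i *m (u j)^T).
have m0 : (m%:R : R) != 0 by rewrite pnatr_eq0 -lt0n.
have -> : \sum_i rsign (s i) * (ys i * dotp (\sum_j al j *: (A^T *m u j)) (xs i)) =
    m%:R * \sum_j al j * \tr ((B j)^T *m A).
  under eq_bigr do rewrite -kfun_dotp /kfun mulrA mulr_sumr.
  rewrite exchange_big mulr_sumr; apply: eq_bigr => j _ /=.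
  rewrite /B linearZ /= -scalemxAl mxtraceZ mulrCA mulVKf//.
  rewrite linear_sum mulmx_suml raddf_sum mulr_sumr; apply: eq_bigr => i _.
  by rewrite linearZ /= -scalemxAl mxtraceZ KAE// mulrCA.
rewrite ler_wpM2l//; apply: le_trans (ler_norm _) _.
apply: weighted_sum_bound => // [|j]; first exact: rad_sup_ge0.
apply: le_trans (dual_norm_pairing hN _ _ NA) _; first by rewrite invr_gt0.
apply: ler_wpM2r; first by rewrite invr_ge0 ltW.
exact: dual_norm_le_rad_sup.
Qed.

Lemma rad_avg_ge0 : 0 <= rad_avg N X xs ys.
Proof.
by rewrite mulr_ge0 ?invr_ge0// sumr_ge0// => s _; exact: rad_sup_ge0.
Qed.
End Sample.
End KernelClass.

(** Rational points may miss [V]. For each rational centre and radius [1/(n+1)], a point of [V] that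
    close to the centre is chosen if there is one, and [v0] otherwise; these pairs are countable. *)
Lemma separable_cV {R : realType} {d : nat} (V : set 'cV[R]_d) : V !=set0 ->
  exists2 D : nat -> 'cV[R]_d, (forall n, V (D n)) &
    forall v e, V v -> 0 < e -> exists n, forall k, `|v k 0 - D n k 0| < e.
Proof.
move=> [v0 Vv0].
pose near (p : {ffun 'I_d -> rat} * nat) v :=
  V v /\ forall k, `|v k 0 - ratr (p.1 k)| < p.2.+1%:R^-1.
have choose p : {v | V v /\ ((exists v', near p v') -> near p v)}.
  have [h|h] := pselect (exists v', near p v'); last by exists v0.
  by have [v pv] := cid h; exists v; split=> //; case: pv.
pose D n := if @unpickle ({ffun 'I_d -> rat} * nat)%type n is Some p then sval (choose p) else v0.
exists D => [n|v e Vv e0].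
  by rewrite /D; case: (unpickle n) => // p; have [] := svalP (choose p).
(* Half of [e], because the given point and the chosen one are both compared with the same rational
   centre. *)
have e2 : 0 < e / 2 by rewrite divr_gt0.
have [n ne] : exists n, n.+1%:R^-1 < e / 2.
  exists (Num.truncn (e / 2)^-1); rewrite invf_plt ?posrE ?ltr0n//.
  exact: truncnS_gt.
have [t t0 tE] : exists2 t : R, 0 < t & n.+1%:R^-1 = t.
  by exists n.+1%:R^-1; rewrite // invr_gt0.
rewrite tE in ne; have approx k : {q : rat | `|v k 0 - ratr q| < t}.
  apply: cid; have /rat_in_itvoo[q] : v k 0 - t < v k 0 + t by lra.
  by rewrite in_itv/= => /andP[q1 q2]; exists q; rewrite ltr_norml; apply/andP; split; lra.
pose p : {ffun 'I_d -> rat} * nat := ([ffun k => sval (approx k)], n).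
have npv : near p v by split=> // k; rewrite ffunE /= tE; exact: svalP (approx k).
exists (pickle p) => k; rewrite /D pickleK.
have [_ /(_ (ex_intro _ v npv))[_ /(_ k) h1]] := svalP (choose p).
have [_ /(_ k) h2] := npv.
rewrite -(subrKA (ratr (p.1 k))) (le_lt_trans (ler_normD _ _))//.
rewrite [`|ratr _ - _|]distrC; rewrite /= tE in h1 h2; lra.
Qed.

(* The integral of a nonnegative function is a supremum over simple functions
   below it, hence monotone without measurability; the Rademacher average is
   not shown to be measurable. *)
Lemma ge0_le_integral_nonmeasurable {R : realType} {d} {T : measurableType d}
    (mu : {measure set T -> \bar R}) (f g : T -> \bar R) :
  (forall x, 0 <= f x)%E -> (forall x, f x <= g x)%E ->
  (\int[mu]_x f x <= \int[mu]_x g x)%E.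
Proof.
move=> f0 fg; have g0 x : (0 <= g x)%E by exact: le_trans (fg x).
rewrite !ge0_integralTE//; apply: le_ereal_sup => _ [h hf <-]; exists h => // x.
exact: le_trans (fg x).
Qed.

(** * The generalization bound *)

Section MetricLearning.
Context {R : realType} {d m : nat} (hm : (0 < m)%N).
Variables (X : set 'cV[R]_d) (hX : bounded_set X).
Context {dZ : measure_display} {Z : measurableType dZ} (rho : probability Z R).
Variables (px : Z -> 'cV[R]_d) (py : Z -> R).
Hypotheses (hpx : forall k, measurable_fun setT (fun z => px z k 0))
  (hpy : measurable_fun setT py)
  (hpxX : forall z, X (px z)) (hpyY : forall z, py z = 1 \/ py z = -1).
Variables (r lambda : R) (hr : 0 < r) (hl : 0 < lambda).
Variables (N : 'M[R]_d -> R) (hN : is_matrix_norm N).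

Let L : R := (lambda * r)^-1 * Xstar N X.
Let V := kernel_vectors N X r lambda.

Let lr0 : 0 < (lambda * r)^-1. Proof. by rewrite invr_gt0 mulr_gt0. Qed.

Let L0 : 0 <= L. Proof. by rewrite mulr_ge0 ?(ltW lr0)// Xstar_ge0. Qed.

Definition margin v z : R := py z * dotp v (px z).
Definition hinge (t : R) : R := pos_part (1 - t).

Lemma hinge_lipschitz x y : `|hinge x - hinge y| <= `|x - y|.
Proof.
rewrite /hinge /pos_part ler_norml; have := ler_norm (x - y).
have := ler_norm (- (x - y)); rewrite normrN => h1 h2.
have [p|p] := lerP (1 - x) 0; have [q|q] := lerP (1 - y) 0;
  by apply/andP; split; lra.
Qed.

Let norm_py z : `|py z| = 1.
Proof. by case: (hpyY z) => ->; rewrite ?normrN normr1. Qed.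

Lemma margin_bound v z : V v -> `|margin v z| <= L.
Proof. by move=> Vv; rewrite normrM norm_py mul1r; exact: dotp_kernel_bound. Qed.

Lemma bmf_margin v : V v -> bmf (margin v).
Proof.
move=> Vv; split; last by exists L => z; exact: margin_bound.
apply: measurable_funM => //; apply: measurable_sum => k.
exact: measurable_funM.
Qed.

Lemma bmf_hinge_margin v : V v -> bmf (fun z => hinge (margin v z)).
Proof.
move=> Vv; apply: bmf_max; last exact: bmf_cst.
by apply: bmfB; [exact: bmf_cst|exact: bmf_margin].
Qed.

Lemma hinge_margin_diff v z z' : V v ->
  `|hinge (margin v z) - hinge (margin v z')| <= 2 * L.
Proof.
move=> Vv; apply: le_trans (hinge_lipschitz _ _) _.
apply: le_trans (ler_normB _ _) _.
by have := margin_bound z Vv; have := margin_bound z' Vv; lra.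
Qed.

Section Concentration.
Context {dO : measure_display} {Omega : measurableType dO} (P : probability Omega R).
Variables (zs : 'I_m -> Omega -> Z) (hiid : iid_sample P rho zs).
Variables (D : nat -> 'cV[R]_d) (VD : forall n, V (D n)).

Let g f z := hinge (margin (D f) z).
Let gm f : R := \int[rho]_z g f z.
Let Psi n w := mx n (fun f => \sum_j (gm f - g f (zs j w))).
Let rad w := rad_avg N X (fun i => px (zs i w)) (fun i => py (zs i w)).

Let m0 : (0 : R) < m%:R. Proof. by rewrite ltr0n. Qed.

(** The measurable symmetrized maximum [Q] lies pointwise below a multiple of [rad]. Its positive
    part is used, since the comparison of integrals without measurability of [rad] requires a
    nonnegative function. *)
Lemma expected_deviation_le n q : (\int[P]_w (rad w)%:E = q%:E)%E ->
  \int[P]_w Psi n w <= m%:R * (2 * (lambda * r)^-1 * q).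
Proof.
move=> radq.
have := symmetrization_contraction hiid n (fun f => bmf_margin (VD f))
  (fun f => bmf_hinge_margin (VD f)) hinge_lipschitz.
move=> h; apply: le_trans h _.
set Q := fun w => _.
have bQ : bmf Q.
  apply: bmfZ; apply: bmf_sum => s _; apply: bmf_mx => f; apply: bmfZ.
  apply: bmf_sum => j _; apply: bmfZ; apply: bmf_comp (bmf_margin (VD f)) _.
  by case: hiid.
have Qrad w : Q w <= m%:R * (2 * (lambda * r)^-1) * rad w.
  rewrite /Q /rad /rad_avg mulrCA ler_wpM2l ?invr_ge0// mulr_sumr.
  apply: ler_sum => s _; apply: mx_le => f.
  have := rademacher_kernel_bound hN hX hl hm (fun i => py (zs i w))
    (fun i => hpxX (zs i w)) s (VD f).
  by rewrite /margin; lra.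
set K := m%:R * (2 * (lambda * r)^-1) in Qrad *.
have K0 : 0 < K by rewrite !mulr_gt0.
have b0 : bmf (fun w => K^-1 * Num.max (Q w) 0).
  by apply: bmfZ; apply: bmf_max => //; exact: bmf_cst.
have r0 w : 0 <= rad w by apply: rad_avg_ge0.
have : (\int[P]_w (K^-1 * Num.max (Q w) 0)%:E <= \int[P]_w (rad w)%:E)%E.
  apply: ge0_le_integral_nonmeasurable => w; rewrite lee_fin.
    by rewrite mulr_ge0 ?invr_ge0 ?(ltW K0)// le_max lexx orbT.
  rewrite ler_pdivrMl// ge_max Qrad /=.
  by rewrite mulr_ge0// ltW.
rewrite radq bmf_EFin_Rintegral// lee_fin bmf_integralZ; last first.
  by apply: bmf_max => //; exact: bmf_cst.
rewrite ler_pdivrMl// mulrA => h; apply: le_trans h.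
apply: bmf_le => //; first by apply: bmf_max => //; exact: bmf_cst.
by move=> w; rewrite le_max lexx.
Qed.

Variables (delta : R) (hd0 : 0 < delta) (hd1 : delta < 1).
Let T : R := 2 * L * Num.sqrt (2 * ln (delta^-1) / m%:R).

Lemma finite_class_tail n q : (\int[P]_w (rad w)%:E = q%:E)%E ->
  (P [set w | (m%:R * (2 * (lambda * r)^-1 * q) + m%:R * T < Psi n w)%R] <= delta%:E)%E.
Proof.
move=> radq; have ePsi := expected_deviation_le n radq.
pose b f := \sum_(j < m) gm f.
have PsiE w : Psi n w = mx n (fun f => b f - \sum_j g f (zs j w)).
  by apply: eq_mx => f; rewrite sumrB.
have q0 : 0 <= q.
  rewrite -lee_fin -radq; apply: integral_ge0 => w _; rewrite lee_fin.
  exact: rad_avg_ge0.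
have ln0 : 0 <= ln delta^-1 by rewrite ln_ge0// invf_ge1// ltW.
(* If [L = 0], all margins vanish, the loss is constantly 1 and there is no deviation. Otherwise one
   may divide by [2 * L]. *)
have [L00|Lpos] := eqVneq L 0.
  rewrite (_ : [set w | _] = set0) ?measure0 ?lee_fin 1?ltW//.
  apply/seteqP; split=> // w /=; apply/negP; rewrite -leNgt.
  rewrite /T L00 mulr0 mul0r mulr0 addr0.
  apply: (@le_trans _ _ 0); last by rewrite !mulr_ge0// ltW.
  have g1 f z : g f z = 1.
    have := margin_bound z (VD f); rewrite L00 normr_le0 => /eqP mE.
    by rewrite /g mE /hinge /pos_part subr0; apply: max_l.
  apply: mx_le => f; rewrite big1// => j _.
  rewrite g1 /gm; under eq_Rintegral do rewrite g1.
  by rewrite prob_Rintegral_cst subrr.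
have L1 : 0 < L by rewrite lt_neqAle eq_sym Lpos.
(* The minimiser of the Chernoff exponent for differences [2 * L] and deviation [m * T]; the choice
   of [T] makes the minimum equal to [- ln (1 / delta)]. *)
pose s := T / (2 * L) ^+ 2.
have T0 : 0 <= T by apply: mulr_ge0; [exact: mulr_ge0|exact: sqrtr_ge0].
have s0 : 0 <= s by rewrite divr_ge0// sqr_ge0.
have ePsi' : \int[P]_w mx n (fun f => b f - \sum_j g f (zs j w)) <=
    m%:R * (2 * (lambda * r)^-1 * q).
  by under eq_Rintegral do rewrite -PsiE.
have tail := mx_deviation_tail hiid (fun f => bmf_hinge_margin (VD f))
  (fun f z z' => hinge_margin_diff z z' (VD f)) (m%:R * T) s0 ePsi'.
under eq_set do rewrite PsiE.
apply: le_trans tail _; rewrite lee_fin.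
have -> : m%:R * (s ^+ 2 * (2 * L) ^+ 2 / 2) - s * (m%:R * T) = - ln delta^-1.
  have Tsq : T ^+ 2 = (2 * L) ^+ 2 * (2 * ln delta^-1 / m%:R).
    rewrite /T exprMn sqr_sqrtr//.
    by apply: mulr_ge0; [exact: mulr_ge0|rewrite invr_ge0 ltW].
  have -> : m%:R * (s ^+ 2 * (2 * L) ^+ 2 / 2) - s * (m%:R * T) =
      - (m%:R * (T ^+ 2 / (2 * L) ^+ 2) / 2).
    by rewrite /s; field.
  by rewrite Tsq; field; rewrite Lpos gt_eqF.
by rewrite lnV// opprK lnK.
Qed.

(** The bad events [A n] increase with [n], so continuity of the measure from below carries the
    bound [delta] over to their union; [E] is its complement. *)
Lemma countable_class_tail q : (\int[P]_w (rad w)%:E = q%:E)%E ->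
  exists E : set Omega, [/\ measurable E, (P E >= (1 - delta)%:E)%E &
    forall w, E w -> forall f, \sum_j (gm f - g f (zs j w)) <=
      m%:R * (2 * (lambda * r)^-1 * q) + m%:R * T].
Proof.
move=> radq; set C := m%:R * _ + _.
pose A n := [set w | C < Psi n w].
have bPsi n : bmf (Psi n).
  apply: bmf_mx => f; apply: bmf_sum => j _; apply: bmfB; first exact: bmf_cst.
  by apply: bmf_comp (bmf_hinge_margin (VD f)) _; case: hiid.
have mA n : measurable (A n).
  rewrite -[X in measurable X]setTI; have [mP _] := bPsi n.
  rewrite (_ : A n = Psi n @^-1` `]C, +oo[); first exact: mP.
  by apply/seteqP; split=> w /=; rewrite in_itv/= andbT.
have mU : measurable (\bigcup_n A n) by exact: bigcupT_measurable.
have ndA : nondecreasing_seq A.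
  apply/nondecreasing_seqP => n; apply/subsetPset => w; rewrite /A /= => h.
  by rewrite /Psi /= lt_max h.
exists (~` \bigcup_n A n); split; first exact: measurableC.
  rewrite probability_setC// EFinB leeB//.
  rewrite -(cvg_lim _ (nondecreasing_cvg_mu mA mU ndA))//.
  apply: lime_le; first by apply/cvg_ex; eexists; exact: nondecreasing_cvg_mu.
  by apply: nearW => n; exact: finite_class_tail radq.
move=> w nA f; rewrite leNgt; apply/negP => h; apply: nA; exists f => //.
by apply: lt_le_trans h _; exact: (le_mx (fun f => \sum_j (gm f - g f (zs j w)))).
Qed.

End Concentration.
Lemma hinge_margin_dotp (v v' : 'cV[R]_d) (e K : R) z : (forall x, X x -> \sum_k `|x k 0| <= K) ->
  0 <= e -> (forall k, `|v k 0 - v' k 0| <= e) ->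
  hinge (margin v z) <= hinge (margin v' z) + e * K.
Proof.
move=> hK e0 vv'; rewrite -lerBlDl; apply: le_trans (ler_norm _) _.
apply: le_trans (hinge_lipschitz _ _) _.
rewrite -mulrBr normrM norm_py mul1r /dotp -sumrB.
apply: le_trans (ler_norm_sum _ _ _) _.
apply: (@le_trans _ _ (e * \sum_k `|px z k 0|)); last by rewrite ler_wpM2l// hK.
by rewrite mulr_sumr; apply: ler_sum => k _; rewrite -mulrBl normrM ler_wpM2r.
Qed.

Lemma deviation_le_dense (D : nat -> 'cV[R]_d) (zs : 'I_m -> Z) B :
  (forall n, V (D n)) ->
  (forall v e, V v -> 0 < e -> exists n, forall k, `|v k 0 - D n k 0| < e) ->
  (forall n, \sum_j (\int[rho]_z hinge (margin (D n) z) - hinge (margin (D n) (zs j)))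
     <= m%:R * B) ->
  forall v, V v ->
  \int[rho]_z hinge (margin v z) - m%:R^-1 * \sum_j hinge (margin v (zs j)) <= B.
Proof.
move=> VD denseD DB v Vv; have [K K0 hK] := dotp_bounded hX.
have m0 : (0 : R) < m%:R by rewrite ltr0n.
apply/ler_addgt0Pr => eps eps0.
(* The population and the empirical term each move by at most [e * K]; the added 1 keeps the
   denominator positive when [K = 0]. *)
pose e := eps / (2 * K + 1).
have K1 : 0 < 2 * K + 1 by lra.
have e0 : 0 < e by rewrite divr_gt0.
have [n vn] := denseD v e Vv e0.
have vD k : `|v k 0 - D n k 0| <= e by exact: ltW.
have Dv k : `|D n k 0 - v k 0| <= e by rewrite distrC.
have pop : \int[rho]_z hinge (margin v z) <= \int[rho]_z hinge (margin (D n) z) + e * K.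
  rewrite -[X in _ + X](prob_Rintegral_cst rho) -bmf_integralD; last 2 first.
  - exact: bmf_hinge_margin.
  - exact: bmf_cst.
  apply: bmf_le => [||z]; first exact: bmf_hinge_margin.
  - by apply: bmfD; [exact: bmf_hinge_margin|exact: bmf_cst].
  - exact: hinge_margin_dotp hK (ltW e0) vD.
have emp : m%:R^-1 * \sum_j hinge (margin (D n) (zs j)) <=
    m%:R^-1 * (\sum_j hinge (margin v (zs j))) + e * K.
  have -> : e * K = m%:R^-1 * \sum_(j < m) e * K.
    by rewrite sumr_const card_ord -[e * K *+ m]mulr_natl mulKf// gt_eqF.
  rewrite -mulrDr -big_split ler_wpM2l ?invr_ge0//; apply: ler_sum => j _.
  exact: hinge_margin_dotp hK (ltW e0) Dv.
have mid : \int[rho]_z hinge (margin (D n) z) -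
    m%:R^-1 * \sum_j hinge (margin (D n) (zs j)) <= B.
  have := DB n; rewrite sumrB sumr_const card_ord -[_ *+ m]mulr_natl.
  by rewrite -ler_pdivrMl// mulrBr mulKf// gt_eqF.
have eK : 2 * (e * K) <= eps.
  have -> : 2 * (e * K) = eps * (2 * K) / (2 * K + 1) by rewrite /e; ring.
  by rewrite ler_pdivrMr// ler_wpM2l ?(ltW eps0)// lerDl.
lra.
Qed.

Lemma pop_riskE v (f : 'cV[R]_d -> R) : V v -> (forall x, f x = dotp v x) ->
  pop_risk rho px py f = (\int[rho]_z hinge (margin v z))%:E.
Proof.
move=> Vv fE; rewrite -bmf_EFin_Rintegral; last exact: bmf_hinge_margin.
by apply: eq_integral => z _; rewrite fE.
Qed.

Lemma emp_riskE v (f : 'cV[R]_d -> R) (zs : 'I_m -> Z) : (forall x, f x = dotp v x) ->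
  emp_risk (fun i => px (zs i)) (fun i => py (zs i)) f =
  m%:R^-1 * \sum_j hinge (margin v (zs j)).
Proof. by move=> fE; congr (_ * _); apply: eq_bigr => j _; rewrite fE. Qed.

Lemma regularized_minimizer_norm (xs : 'I_m -> 'cV[R]_d) (ys : 'I_m -> R) A :
  (forall A', symmetric_mx A' -> Ez_mat r xs ys A + lambda * N A <=
    Ez_mat r xs ys A' + lambda * N A') -> N A <= lambda^-1.
Proof.
move=> /(_ 0 (trmx0 _ _ _)); rewrite (matrix_norm0 hN) mulr0 addr0 => h.
have E0 : Ez_mat r xs ys 0 = 1.
  rewrite /Ez_mat (eq_bigr (fun=> 1)) => [|i _].
    by rewrite sumr_const card_ord mulVf// pnatr_eq0 -lt0n.
  rewrite big1 => [|j _]; last by rewrite /KA mulmx0 mul0mx mxE mulr0.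
  by rewrite mulr0 subr0; apply: max_l.
have Ege0 : 0 <= Ez_mat r xs ys A.
  rewrite mulr_ge0 ?invr_ge0// sumr_ge0// => i _.
  by rewrite /pos_part le_max lexx orbT.
by rewrite -[lambda^-1]mulr1 ler_pdivlMl//; lra.
Qed.

End MetricLearning.

(** Makes the class nonempty, as the choice of a dense sequence requires; the combination with no
    terms is used. *)
Lemma kernel_vectors0 {R : realType} {d} (N : 'M[R]_d -> R) X (r lambda : R) :
  is_matrix_norm N -> 0 < r -> 0 < lambda -> kernel_vectors N X r lambda 0.
Proof.
move=> hN r0 l0; exists 0%N, 0, (fun=> 0), (fun=> 0).
split; rewrite ?(matrix_norm0 hN) ?big_ord0 ?invr_ge0 ?(ltW r0) ?(ltW l0)//.
- exact: trmx0.
- by case.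
Qed.

Unset Implicit Arguments.

Theorem theorem4 (R : realType) (d m : nat) (hm : (0 < m)%N)
  (Xd : set 'cV[R]_d) (hXb : bounded_set Xd) (hXo : open Xd) (hXc : connected Xd)
  (dZ : measure_display) (Z : measurableType dZ) (rho : probability Z R)
  (px : Z -> 'cV[R]_d) (py : Z -> R)
  (hpx : forall k, measurable_fun setT (fun z => px z k 0))
  (hpy : measurable_fun setT py)
  (hpxX : forall z, Xd (px z)) (hpyY : forall z, py z = 1 \/ py z = -1)
  (dO : measure_display) (Omega : measurableType dO) (P : probability Omega R)
  (zs : 'I_m -> Omega -> Z) (hiid : iid_sample P rho zs)
  (r lambda : R) (hr : 0 < r) (hl : 0 < lambda)
  (N : 'M[R]_d -> R) (hN : is_matrix_norm N)
  (Az : Omega -> 'M[R]_d)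
  (hAz : forall w, symmetric_mx (Az w) /\
     forall A, symmetric_mx A ->
       Ez_mat r (fun i => px (zs i w)) (fun i => py (zs i w)) (Az w) + lambda * N (Az w)
       <= Ez_mat r (fun i => px (zs i w)) (fun i => py (zs i w)) A + lambda * N A)
  (alpha : Omega -> 'I_m -> R)
  (halpha : forall w, \sum_(j < m) `|alpha w j| <= r^-1 /\
     forall beta : 'I_m -> R, \sum_(j < m) `|beta j| <= r^-1 ->
       emp_risk (fun i => px (zs i w)) (fun i => py (zs i w))
                (kfun (Az w) (fun i => px (zs i w)) (alpha w))
       <= emp_risk (fun i => px (zs i w)) (fun i => py (zs i w))
                (kfun (Az w) (fun i => px (zs i w)) beta))
  (delta : R) (hd0 : 0 < delta) (hd1 : delta < 1) :
  let Rm : \bar R :=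
    (\int[P]_w (rad_avg N Xd (fun i => px (zs i w)) (fun i => py (zs i w)))%:E)%E in
  exists E : set Omega, [/\ measurable E, (P E >= (1 - delta)%:E)%E &
    forall w, E w ->
      let fz := kfun (Az w) (fun i => px (zs i w)) (alpha w) in
      (pop_risk rho px py fz
         - (emp_risk (fun i => px (zs i w)) (fun i => py (zs i w)) fz)%:E
       <= (4 / (lambda * r))%:E * Rm
          + (2 * Xstar N Xd / (lambda * r)
             * Num.sqrt (2 * ln (delta^-1) / m%:R))%:E)%E].
Proof.
move=> Rm.
have Rm0 : (0 <= Rm)%E.
  by apply: integral_ge0 => w _; rewrite lee_fin; exact: rad_avg_ge0.
have lr0 : 0 < lambda * r by rewrite mulr_gt0.
(* If the Rademacher average is infinite, the right-hand side is infinite and the whole space serves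
   as [E]. *)
case RmE : Rm Rm0 => [q||] // Rm0; last first.
  exists setT; split=> //; first by rewrite probability_setT lee_fin gerBl ltW.
  by move=> w _ /=; rewrite gt0_muley ?addye ?leey// lte_fin divr_gt0.
have [D VD denseD] := separable_cV (ex_intro _ _ (kernel_vectors0 Xd hN hr hl)).
have [E [mE PE hE]] := countable_class_tail hm hXb hpx hpy hpxX hpyY hr hl hN hiid VD hd0 hd1 RmE.
exists E; split=> // w Ew /=.
pose v := \sum_j alpha w j *: ((Az w)^T *m px (zs j w)).
have [sA minA] := hAz w; have [salpha _] := halpha w.
have Vv : kernel_vectors N Xd r lambda v.
  exists m, (Az w), (fun j => px (zs j w)), (alpha w); split=> //.
  exact: (regularized_minimizer_norm hm hl hN minA).
have fE := kfun_dotp (Az w) (fun j => px (zs j w)) (alpha w).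
rewrite (pop_riskE hXb rho hpx hpy hpxX hpyY hl hN Vv fE) (emp_riskE px py (fun j => zs j w) fE).
rewrite -EFinM -EFinB -EFinD lee_fin.
pose T := 2 * ((lambda * r)^-1 * Xstar N Xd) * Num.sqrt (2 * ln delta^-1 / m%:R).
have := deviation_le_dense (rho := rho) hm hXb hpx hpy hpxX hpyY hl hN
  (zs := fun j => zs j w) (B := 2 * (lambda * r)^-1 * q + T) VD denseD.
(* The Rademacher term has been obtained with constant 2, which is at most 4; the deviation terms
   agree. *)
rewrite mulrDr => /(_ (hE w Ew) v Vv) h; apply: le_trans h _; apply: lerD.
  apply: ler_wpM2r; first by [].
  by apply: ler_wpM2r; [rewrite invr_ge0 ltW|rewrite ler_nat].
by rewrite /T le_eqVlt; apply/orP; left; apply/eqP; congr (_ * _); ring.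
Qed.
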